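(* There are exactly $33$ integral equivalence classes of smooth $3$-dimensional lattice polytopes with at most $12$ lattice points. Sorted by number of vertices, there are: $2$ classes with $4$ vertices, $25$ classes with $6$ vertices, $6$ classes with $8$ vertices, $0$ classes with $10$ vertices, and $0$ classes with $12$ vertices.
   Context: Let $M\cong\mathbb{Z}^3$, $N=\mathrm{Hom}(M,\mathbb{Z})$. A $3$-dimensional lattice polytope $P$ is a three-dimensional convex hull of finitely many points of $M$ in $M\otimes\mathbb{R}$. It is smooth if at every vertex $u$ the normal cone $\{v\in N\otimes\mathbb{R}:\langle u'-u,v\rangle\ge0\ \forall u'\in P\}$ is unimodular, i.e. its primitive minimal generators form a lattice basis of $N$. Two such polytopes are integrally equivalent if an affine map that maps one lattice bijectively onto the other maps one polytope onto the other. Lattice points of $P$ are the points of $P\cap M$. *)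

(* Defs.v *)
From HB Require Import structures.
From mathcomp Require Import all_boot all_order all_algebra.
From mathcomp Require Import boolp classical_sets functions cardinality reals.
From mathcomp Require Import convex.

Set Implicit Arguments.
Unset Strict Implicit.
Unset Printing Implicit Defensive.

Import Order.TTheory GRing.Theory Num.Theory.

Local Open Scope classical_set_scope.
Local Open Scope card_scope.
Local Open Scope ring_scope.

(* M = Z^n is 'rV[int]_n, inside 'rV[R]_n = M (x) R; its dual N = Hom(M, Z) is
   'cV[int]_n, inside 'cV[R]_n = N (x) R, with the following pairing. *)
Definition pairing (R : realType) (n : nat) (u : 'rV[R]_n) (v : 'cV[R]_n) : R :=
  (u *m v) ord0 ord0.

Definition lattice (R : realType) (n : nat) : set 'rV[R]_n :=
  range (map_mx (intr : int -> R)).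
Arguments lattice : clear implicits.

Definition convex_hull (R : realType) (V : lmodType R) (A : set V) : set V :=
  smallest (@convex_set R V) A.

Definition lattice_polytope (R : realType) (n : nat) (P : set 'rV[R]_n) : Prop :=
  exists S : set 'rV[R]_n,
    [/\ finite_set S, S `<=` lattice R n & P = convex_hull S].

(* P contains n + 1 affinely independent points. *)
Definition full_dimensional (R : realType) (n : nat) (P : set 'rV[R]_n) : Prop :=
  exists (u : 'rV[R]_n) (B : 'M[R]_n),
    [/\ P u, (forall i, P (u + row i B)) & row_free B].

(* The zero-dimensional faces of P. *)
Definition vertices (R : realType) (n : nat) (P : set 'rV[R]_n) : set 'rV[R]_n :=
  [set u | P u /\ exists v : 'cV[R]_n,
     forall u', P u' -> u' <> u -> 0 < pairing (u' - u) v].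

Definition normal_cone (R : realType) (n : nat) (P : set 'rV[R]_n)
    (u : 'rV[R]_n) : set 'cV[R]_n :=
  [set v | forall u', P u' -> 0 <= pairing (u' - u) v].

(* The zero vector is not primitive, since 0 = 2 *: 0. *)
Definition primitive (n : nat) (v : 'cV[int]_n) : Prop :=
  forall (k : int) (w : 'cV[int]_n), v = k *: w -> `|k| = 1.

(* v spans an extreme ray of the cone sigma. *)
Definition spans_extreme_ray (R : realType) (n : nat) (sigma : set 'cV[R]_n)
    (v : 'cV[R]_n) : Prop :=
  [/\ sigma v, v != 0 &
      forall x y, sigma x -> sigma y -> x + y = v ->
        exists2 r : R, 0 <= r & x = r *: v].

(* A pointed polyhedral cone is generated by its extreme rays, and every
   generating set meets each of them: the minimal generators are unique up to
   positive scaling, and are normalized to be primitive in N. *)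
Definition primitive_minimal_generators (R : realType) (n : nat)
    (sigma : set 'cV[R]_n) : set 'cV[int]_n :=
  [set v | primitive v /\ spans_extreme_ray sigma (map_mx intr v)].

Definition lattice_basis (n : nat) (b : 'I_n -> 'cV[int]_n) : Prop :=
  forall w : 'cV[int]_n,
    exists! c : {ffun 'I_n -> int}, w = \sum_i c i *: b i.

(* Meaningful for pointed rational polyhedral cones, such as the normal cones
   at the vertices of a full-dimensional lattice polytope. *)
Definition unimodular (R : realType) (n : nat) (sigma : set 'cV[R]_n) : Prop :=
  exists2 b : 'I_n -> 'cV[int]_n,
    lattice_basis b & primitive_minimal_generators sigma = range b.

Definition smooth_polytope (R : realType) (n : nat) (P : set 'rV[R]_n) : Prop :=
  [/\ lattice_polytope P, full_dimensional P &
      forall u, vertices P u -> unimodular (normal_cone P u)].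

Definition affine_map (R : realType) (n : nat)
    (f : 'rV[R]_n -> 'rV[R]_n) : Prop :=
  exists (A : 'M[R]_n) (b : 'rV[R]_n), forall x, f x = x *m A + b.

Definition integrally_equivalent (R : realType) (n : nat)
    (P Q : set 'rV[R]_n) : Prop :=
  exists f : 'rV[R]_n -> 'rV[R]_n,
    [/\ affine_map f, set_bij (lattice R n) (lattice R n) f & f @` P = Q].

(* The integral equivalence classes of the polytopes in the family X. *)
Definition equivalence_classes (R : realType) (n : nat)
    (X : set (set 'rV[R]_n)) : set (set (set 'rV[R]_n)) :=
  [set [set Q | X Q /\ integrally_equivalent P Q] | P in X].

Definition small_smooth_polytopes (R : realType) (n m : nat) :
    set (set 'rV[R]_n) :=
  [set P | smooth_polytope P /\ (P `&` lattice R n) #<= `I_m].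
Arguments small_smooth_polytopes : clear implicits.

Definition small_smooth_polytopes_with_vertices (R : realType) (n m k : nat) :
    set (set 'rV[R]_n) :=
  [set P | small_smooth_polytopes R n m P /\ vertices P #= `I_k].
Arguments small_smooth_polytopes_with_vertices : clear implicits.

(* Main.v *)
(** A polytope [P] with at most [m] lattice points is recovered from the finite
    set [S] of its lattice points.  The cone at each vertex of [P] is spanned by
    a lattice basis, and the neighbouring lattice points along the edges lie in
    [S]; an edge of lattice length [k] from a vertex with edge directions
    [d1, d2, d3] leads to a vertex with directions
    [- d1, d2 + a d1, d3 + a' d1] for some integers [a, a'], and the rows of
    lattice points parallel to the edge in the two adjacent facets bound [k],
    [a] and [a'].  Starting from a vertex in standard position, following edges
    therefore gives a finite search tree; it is pruned by the number of points
    and by the inequalities of the facets found so far, and each of its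
    surviving leaves determines the polytope, which is an image of one of 33
    explicit ones.  These are inequivalent because the sum over all quadruples
    of vertices of the fourth power of the volume of their simplex is an affine
    unimodular invariant which separates them. *)

Require Import Defs.
From Stdlib Require Import ZArith Lia.
From mathcomp Require Import all_boot all_order all_algebra.
From mathcomp Require Import ssrZ ring.
From mathcomp Require Import boolp classical_sets functions cardinality reals.
From mathcomp Require Import interval_inference convex.

Set Implicit Arguments.
Unset Strict Implicit.
Unset Printing Implicit Defensive.

Import Order.TTheory GRing.Theory Num.Theory.

(* [ssrint] has taken the key [Z] for the scope of [int]. *)
Delimit Scope Z_scope with coqZ.

Local Open Scope Z_scope.

(** * Lattice frames *)

(** Smoothness is stated through extreme rays of real normal cones, whereas the search needs edge
    directions of the polytope and integer data that [vm_compute] can handle. [edge_point] bridges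
    the two: if no lattice point lay on the ray along [dir1], some extreme ray of the normal cone
    would be negative on [dir1], but the only extreme rays are the three normals, which are
    nonnegative there. The polytope is thereby replaced by a finite list with [smooth_points], and
    the classification of such lists is purely integral. Each listed polytope carries both vertices
    and inequalities. Transported vertices lying in [S] give one inclusion, transported inequalities
    valid on [S] the other, so a leaf of the search needs no convex hull computation. The same
    double description lets a computation check that the 33 polytopes are smooth and small
    enough. *)

Notation pt := (Z * Z * Z)%type.

Definition pt_eqb (p q : pt) : bool :=
  let: (x, y, z) := p in let: (x', y', z') := q in
  if Z.eqb x x' then if Z.eqb y y' then Z.eqb z z' else false else false.

Definition padd (p q : pt) : pt :=
  let: (x, y, z) := p in let: (x', y', z') := q in (x + x', y + y', z + z').

Definition pscale (k : Z) (p : pt) : pt :=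
  let: (x, y, z) := p in (k * x, k * y, k * z).

Definition psub (p q : pt) : pt := padd p (pscale (-1) q).

Definition dot (p q : pt) : Z :=
  let: (x, y, z) := p in let: (x', y', z') := q in x * x' + y * y' + z * z'.

(* Unlike [has] and [all], these stop early under call-by-value evaluation. *)
Fixpoint hasb T (a : T -> bool) (s : seq T) : bool :=
  if s is x :: s' then if a x then true else hasb a s' else false.

Fixpoint allb T (a : T -> bool) (s : seq T) : bool :=
  if s is x :: s' then if a x then allb a s' else false else true.

Lemma hasbP T (a : T -> bool) s : hasb a s -> exists2 x, List.In x s & a x.
Proof.
elim: s => //= x s IHs; case: ifP => [ax _|_ /IHs [y sy ay]].
  by exists x => //; left.
by exists y => //; right.
Qed.

Lemma allbP T (a : T -> bool) s : reflect (forall x, List.In x s -> a x) (allb a s).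
Proof.
apply: (iffP idP); elim: s => //= x s IHs.
  by case: ifP => // ax /IHs as_ y [<-//|/as_].
by move=> as_; rewrite (as_ x (or_introl erefl)); apply: IHs => y sy; apply: as_; right.
Qed.

Lemma In_mem (T : eqType) (x : T) s : List.In x s <-> x \in s.
Proof.
elim: s => //= y s IHs; rewrite inE; split=> [[->|/IHs ->]|/orP[/eqP ->|/IHs]].
- by rewrite eqxx.
- by rewrite orbT.
- by left.
- by right.
Qed.

Lemma pt_eqbP (p q : pt) : pt_eqb p q -> p = q.
Proof.
case: p => [[x y] z]; case: q => [[x' y'] z'] /=.
by do 2![case: Z.eqb_spec => // ->]; move/Z.eqb_eq->.
Qed.

Definition pmem (p : pt) (L : seq pt) : bool := hasb (pt_eqb p) L.

Lemma pmemP p L : pmem p L -> p \in L.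
Proof. by move=> /hasbP [q /In_mem Lq /pt_eqbP ->]. Qed.

Lemma pt_eqb_refl p : pt_eqb p p.
Proof. by case: p => [[x y] z] /=; rewrite !Z.eqb_refl. Qed.

Lemma pmemE p L : pmem p L = (p \in L).
Proof.
apply/idP/idP => [/pmemP //|]; rewrite /pmem; elim: L => //= q L IHL; rewrite inE.
by case: ifP => // pq /orP[/eqP ep|/IHL //]; move: pq; rewrite ep pt_eqb_refl.
Qed.

Lemma pt_eq (x y z x' y' z' : Z) : x = x' -> y = y' -> z = z' -> (x, y, z) = (x', y', z').
Proof. by move=> -> -> ->. Qed.

Ltac pt_ring :=
  cbv beta iota zeta delta [psub padd pscale dot]; try apply: pt_eq; ring.

Lemma dotDr b p q : dot b (padd p q) = dot b p + dot b q.
Proof. by move: b p q => [[? ?] ?] [[? ?] ?] [[? ?] ?]; pt_ring. Qed.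

Lemma dotZr b k p : dot b (pscale k p) = k * dot b p.
Proof. by move: b p => [[? ?] ?] [[? ?] ?]; pt_ring. Qed.

Lemma dotC b p : dot b p = dot p b.
Proof. by move: b p => [[? ?] ?] [[? ?] ?]; pt_ring. Qed.

Lemma dotBr b p q : dot b (psub p q) = dot b p - dot b q.
Proof. by rewrite /psub dotDr dotZr; lia. Qed.

Lemma dotDl b c p : dot (padd b c) p = dot b p + dot c p.
Proof. by rewrite dotC dotDr !(dotC p). Qed.

Lemma dotZl b k p : dot (pscale k b) p = k * dot b p.
Proof. by rewrite dotC dotZr dotC. Qed.

Lemma dotBl b c p : dot (psub b c) p = dot b p - dot c p.
Proof. by rewrite dotC dotBr !(dotC p). Qed.

Definition dotE := (dotDr, dotZr, dotBr, dotDl, dotZl, dotBl).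

(* A lattice basis [dir_i] at [apex], together with its dual basis [nrm_i]. *)
Record frame := Frame {
  apex : pt; dir1 : pt; dir2 : pt; dir3 : pt; nrm1 : pt; nrm2 : pt; nrm3 : pt }.

Definition comb (c : frame) (p : pt) : pt :=
  let: (x, y, z) := p in
  padd (pscale x (dir1 c)) (padd (pscale y (dir2 c)) (pscale z (dir3 c))).

Definition nrm_coords (c : frame) (p : pt) : pt :=
  (dot (nrm1 c) p, dot (nrm2 c) p, dot (nrm3 c) p).

Definition transport (c : frame) (p : pt) : pt := padd (apex c) (comb c p).

Definition coords (c : frame) (p : pt) : pt := nrm_coords c (psub p (apex c)).

Definition dual_frame (c : frame) : Prop :=
  cancel (comb c) (nrm_coords c) /\ cancel (nrm_coords c) (comb c).

Lemma dual_frame_dot c : dual_frame c ->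
  [/\ nrm_coords c (dir1 c) = (1, 0, 0), nrm_coords c (dir2 c) = (0, 1, 0)
    & nrm_coords c (dir3 c) = (0, 0, 1)].
Proof.
case=> ck _; rewrite -(ck (1, 0, 0)) -(ck (0, 1, 0)) -(ck (0, 0, 1)) /comb.
have comb1 d p q : padd (pscale 1 d) (padd (pscale 0 p) (pscale 0 q)) = d.
  by move: d p q => [[? ?] ?] [[? ?] ?] [[? ?] ?]; pt_ring.
have comb2 d p q : padd (pscale 0 p) (padd (pscale 1 d) (pscale 0 q)) = d.
  by move: d p q => [[? ?] ?] [[? ?] ?] [[? ?] ?]; pt_ring.
have comb3 d p q : padd (pscale 0 p) (padd (pscale 0 q) (pscale 1 d)) = d.
  by move: d p q => [[? ?] ?] [[? ?] ?] [[? ?] ?]; pt_ring.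
by rewrite comb1 comb2 comb3.
Qed.

Lemma dot_dual c b p : dual_frame c ->
  dot b p = dot (nrm1 c) p * dot b (dir1 c) + dot (nrm2 c) p * dot b (dir2 c)
            + dot (nrm3 c) p * dot b (dir3 c).
Proof. by case=> _ kc; rewrite -{1}(kc p) /comb /= !dotE; lia. Qed.

(** The inequalities put [S] inside the cone at [apex c], and the three neighbouring points show
    that no smaller cone will do: the hull of [S] has a smooth vertex there, with edges along the
    three directions. *)
Record cone_at (S : seq pt) (c : frame) : Prop := ConeAt {
  cone_dual : dual_frame c;
  cone_apex : apex c \in S;
  cone_dir1 : padd (apex c) (dir1 c) \in S;
  cone_dir2 : padd (apex c) (dir2 c) \in S;
  cone_dir3 : padd (apex c) (dir3 c) \in S;
  cone_nrm1 : forall p, p \in S -> 0 <= dot (nrm1 c) (psub p (apex c));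
  cone_nrm2 : forall p, p \in S -> 0 <= dot (nrm2 c) (psub p (apex c));
  cone_nrm3 : forall p, p \in S -> 0 <= dot (nrm3 c) (psub p (apex c)) }.

(* What the classification uses of the lattice points of a smooth polytope. *)
Record smooth_points (m : nat) (S : seq pt) : Prop := SmoothPoints {
  points_size : (size S <= m)%N;
  points_convex : forall p d (n t : nat), p \in S ->
    padd p (pscale (Z.of_nat n) d) \in S -> (t <= n)%N ->
    padd p (pscale (Z.of_nat t) d) \in S;
  points_cone : forall u f, u \in S ->
    (forall p, p \in S -> p <> u -> 0 < dot f (psub p u)) ->
    exists2 c, apex c = u & cone_at S c }.

Definition rot (c : frame) : frame :=
  Frame (apex c) (dir2 c) (dir3 c) (dir1 c) (nrm2 c) (nrm3 c) (nrm1 c).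

Definition swap (c : frame) : frame :=
  Frame (apex c) (dir1 c) (dir3 c) (dir2 c) (nrm1 c) (nrm3 c) (nrm2 c).

Lemma dual_frame_rot c : dual_frame c -> dual_frame (rot c).
Proof.
case: c => u d1 d2 d3 b1 b2 b3 [ck kc]; split=> [[[x y] z]|p].
  move: (ck (z, x, y)); rewrite /comb /nrm_coords /=.
  by rewrite !dotE => -[? ? ?]; apply: pt_eq; lia.
rewrite -{2}(kc p) /comb /nrm_coords /=.
by move: (d1) (d2) (d3) => [[? ?] ?] [[? ?] ?] [[? ?] ?]; pt_ring.
Qed.

Lemma dual_frame_swap c : dual_frame c -> dual_frame (swap c).
Proof.
case: c => u d1 d2 d3 b1 b2 b3 [ck kc]; split=> [[[x y] z]|p].
  move: (ck (x, z, y)); rewrite /comb /nrm_coords /=.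
  by rewrite !dotE => -[? ? ?]; apply: pt_eq; lia.
rewrite -{2}(kc p) /comb /nrm_coords /=.
by move: (d1) (d2) (d3) => [[? ?] ?] [[? ?] ?] [[? ?] ?]; pt_ring.
Qed.

Lemma cone_at_rot S c : cone_at S c -> cone_at S (rot c).
Proof. by case=> fc *; split=> //; apply: dual_frame_rot. Qed.

Lemma cone_at_swap S c : cone_at S c -> cone_at S (swap c).
Proof. by case=> fc *; split=> //; apply: dual_frame_swap. Qed.

(* The frame at the other end [apex + k dir1] of the edge in direction [dir1]:
   the two facets at that edge are kept. *)
Definition step (c : frame) (k a a' : Z) : frame :=
  Frame (padd (apex c) (pscale k (dir1 c))) (pscale (-1) (dir1 c))
    (padd (dir2 c) (pscale a (dir1 c))) (padd (dir3 c) (pscale a' (dir1 c)))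
    (psub (padd (pscale a (nrm2 c)) (pscale a' (nrm3 c))) (nrm1 c)) (nrm2 c) (nrm3 c).

(** The row through [apex + dir2] runs to [apex + dir2 + n dir1]; seen from the new apex
    [apex + k dir1], this point is [dir2 + (n - k) dir1]. Lengths, unlike the shears [n - k], are
    natural numbers bounded by the number of points. *)
Definition extension (c : frame) (k n n' : nat) : frame :=
  step c (Z.of_nat k) (Z.of_nat n - Z.of_nat k) (Z.of_nat n' - Z.of_nat k).

Lemma dual_frame_step c k a a' : dual_frame c -> dual_frame (step c k a a').
Proof.
move=> fc; have [] := dual_frame_dot fc; move: fc.
case: c => u d1 d2 d3 b1 b2 b3 [ck kc] [e11 e12 e13] [e21 e22 e23] [e31 e32 e33].
rewrite /= in ck kc e11 e12 e13 e21 e22 e23 e31 e32 e33.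
split=> [[[x y] z]|p].
  rewrite /comb /nrm_coords /= !dotE e11 e12 e13 e21 e22 e23 e31 e32 e33.
  by apply: pt_eq; ring.
rewrite -{2}(kc p) /comb /nrm_coords /= !dotE.
move: (dot b1 p) (dot b2 p) (dot b3 p) => x y z.
move: (d1) (d2) (d3) => [[? ?] ?] [[? ?] ?] [[? ?] ?].
by pt_ring.
Qed.

Lemma padd_inj p q r : padd p q = padd p r -> q = r.
Proof.
by move: p q r => [[? ?] ?] [[? ?] ?] [[? ?] ?] [? ? ?]; apply: pt_eq; lia.
Qed.

(** The [n + 1] points of the row lie in [S] by convexity and are distinct because [b] separates
    them. *)
Lemma row_length m S p d n b : smooth_points m S -> dot b d = 1 ->
  p \in S -> padd p (pscale (Z.of_nat n) d) \in S -> (n < m)%N.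
Proof.
move=> smS bd pS qS; pose f t := padd p (pscale (Z.of_nat t) d).
apply: leq_trans (points_size smS); rewrite -[n.+1](size_iota 0) -(size_map f).
apply: uniq_leq_size => [|_ /mapP[t + ->]].
  rewrite map_inj_uniq ?iota_uniq // => s t /padd_inj /(congr1 (dot b)).
  by rewrite !dotZr bd; lia.
by rewrite mem_iota /= => tn; apply: (points_convex smS) qS _ => //; lia.
Qed.

Lemma upper_bound (T : eqType) (g : T -> Z) (s : seq T) :
  exists M, forall x, x \in s -> g x < M.
Proof.
elim: s => [|x s [M sM]]; first by exists 0.
exists (Z.max (g x + 1) M) => y; rewrite inE => /orP[/eqP ->|/sM]; lia.
Qed.

(** Mutually inverse nonnegative integer matrices are permutation matrices, here in size 2. In
    [edge_step] they compare, modulo the edge, the remaining directions at its two ends. *)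
Lemma nonneg_inverse (y2 y3 z2 z3 b2 b3 c2 c3 : Z) :
  0 <= y2 -> 0 <= y3 -> 0 <= z2 -> 0 <= z3 ->
  0 <= b2 -> 0 <= b3 -> 0 <= c2 -> 0 <= c3 ->
  b2 * y2 + b3 * y3 = 1 -> b2 * z2 + b3 * z3 = 0 ->
  c2 * y2 + c3 * y3 = 0 -> c2 * z2 + c3 * z3 = 1 ->
  [/\ y2 = 1, z2 = 0, y3 = 0 & z3 = 1] \/ [/\ y2 = 0, z2 = 1, y3 = 1 & z3 = 0].
Proof.
move=> y2_ge0 y3_ge0 z2_ge0 z3_ge0 b2_ge0 b3_ge0 c2_ge0 c3_ge0.
have mul1 a b : a * b = 1 -> 0 <= a -> a = 1 /\ b = 1.
  by move=> ab a_ge0; exact: Z.eq_mul_1_nonneg.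
have [? ? ? ?] : [/\ 0 <= b2 * y2, 0 <= b3 * y3, 0 <= b2 * z2 & 0 <= b3 * z3].
  by split; apply: Z.mul_nonneg_nonneg.
have [? ? ? ?] : [/\ 0 <= c2 * y2, 0 <= c3 * y3, 0 <= c2 * z2 & 0 <= c3 * z3].
  by split; apply: Z.mul_nonneg_nonneg.
move=> by_ bz cy cz.
have [[/mul1/(_ b2_ge0)[? ?] ?]|[/mul1/(_ b3_ge0)[? ?] ?]] :
    b2 * y2 = 1 /\ b3 * y3 = 0 \/ b3 * y3 = 1 /\ b2 * y2 = 0.
- lia.
- left; subst; have ? : z2 = 0 by lia.
  have ? : c2 = 0 by lia.
  subst; have ? : c3 * z3 = 1 by lia.
  have [? ?] : c3 = 1 /\ z3 = 1 by apply: mul1.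
  by split; lia.
- right; subst; have ? : z3 = 0 by lia.
  have ? : c3 = 0 by lia.
  subst; have ? : c2 * z2 = 1 by lia.
  have [? ?] : c2 = 1 /\ z2 = 1 by apply: mul1.
  by split; lia.
Qed.

Lemma pscale1 d : pscale 1 d = d.
Proof. by case: d => [[? ?] ?]; pt_ring. Qed.

Lemma psubK u p : padd u (psub p u) = p.
Proof. by move: u p => [[? ?] ?] [[? ?] ?]; pt_ring. Qed.

Lemma mul_nonpos a b : a <= 0 -> 0 <= b -> a * b <= 0.
Proof. nia. Qed.

Lemma mul_eq0_nonpos a b a' b' a'' b'' : a <> 0 ->
  a <= 0 -> a' <= 0 -> a'' <= 0 -> 0 <= b -> 0 <= b' -> 0 <= b'' ->
  0 = a * b + a' * b' + a'' * b'' -> b = 0.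
Proof.
move=> a_neq0 a_le0 a'_le0 a''_le0 b_ge0 b'_ge0 b''_ge0.
have := mul_nonpos a_le0 b_ge0; have := mul_nonpos a'_le0 b'_ge0.
have := mul_nonpos a''_le0 b''_ge0 => ? ? ? ?.
by have /Z.mul_eq_0[//|] : a * b = 0 by lia.
Qed.

Lemma dot_sub_shift b p u k d :
  dot b (psub p (padd u (pscale k d))) = dot b (psub p u) - k * dot b d.
Proof. by rewrite !dotE; lia. Qed.

Lemma dot_shift_sub b u k d i :
  dot b (psub (padd (padd u (pscale k d)) i) u) = k * dot b d + dot b i.
Proof. by rewrite !dotE; lia. Qed.

Lemma mul_eq1_nonpos x a : 1 = x * a -> a <= 0 -> x = -1 /\ a = -1.
Proof.
move=> xa a_le0; have [] : - a = 1 /\ - x = 1 by apply: Z.eq_mul_1_nonneg; lia.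
lia.
Qed.

Lemma sub_mul_nonneg k a : 0 < k -> 0 <= - (k * a) -> a <= 0.
Proof. nia. Qed.

Lemma beyond_edge M k x y z : x < M -> 0 <= y -> 0 <= z -> 0 <= k -> 0 < y + z ->
  0 < Z.max M 0 * (y + z) - x - k * (Z.max M 0 * (0 + 0) - 1).
Proof. nia. Qed.

(** The far end is the last point [q] of [S] on the edge, and it has a cone of its own. The normals
    at [q] are nonpositive on [dir1 c], since the old apex lies in that cone; [nrm2 c] and [nrm3 c]
    are nonnegative on the directions at [q]. These signs force one direction at [q] to be
    [- dir1 c], and the others to be [dir2 c] and [dir3 c] modulo [dir1 c], up to order. *)
Lemma edge_step m S c : smooth_points m S -> cone_at S c ->
  exists k n n', [/\ (0 < k < m)%N, (n < m)%N, (n' < m)%N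
                   & cone_at S (extension c k n n')].
Proof.
move=> smS [fc uS uS1 uS2 uS3 nn1 nn2 nn3].
have [[e11 e12 e13] [e21 e22 e23] [e31 e32 e33]] := dual_frame_dot fc.
set u := apex c in uS uS1 uS2 uS3 nn1 nn2 nn3.
set d1 := dir1 c in e11 e12 e13 uS1; set b1 := nrm1 c in e11 e21 e31 nn1.
set b2 := nrm2 c in e12 e22 e32 nn2; set b3 := nrm3 c in e13 e23 e33 nn3.
pose pnt k := padd u (pscale (Z.of_nat k) d1).
have len k : pnt k \in S -> (k < m)%N by exact: row_length smS e11 uS.
have pnt1 : pnt 1%N \in S by rewrite /pnt pscale1.
have exk : exists k, pnt k \in S by exists 1%N.
have [k kS kmax] := ex_maxnP exk (fun k h => ltnW (len k h)).
have k_gt0 : (0 < k)%N.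
  by apply: kmax.
set q := pnt k in kS.
have bq b p : dot b (psub p q) = dot b (psub p u) - Z.of_nat k * dot b d1.
  exact: dot_sub_shift.
have [M SM] := upper_bound (fun p => dot b1 (psub p u)) S.
(* The functional [K (b2 + b3) - b1], with [K] at least every value of [b1] relative to [u], exposes
   [q]: leaving the edge costs at least [K], and along the edge the value falls until [q]. *)
have [c0 c0q c0S] : exists2 c0, apex c0 = q & cone_at S c0.
  apply: (points_cone smS (f := psub (pscale (Z.max M 0) (padd b2 b3)) b1)) => // p pS pq.
  rewrite bq !(dotBl, dotZl, dotDl) e11 e12 e13.
  have pE : psub p u = comb c (nrm_coords c (psub p u)) by case: fc => _ ->.
  have [y_ge0 z_ge0] := (nn2 p pS, nn3 p pS).
  have kZ_ge0 : 0 <= Z.of_nat k by apply: Nat2Z.is_nonneg.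
  case: (Z.eq_dec (dot b2 (psub p u) + dot b3 (psub p u)) 0) => [yz0|yz]; last first.
    by apply: beyond_edge (SM p pS) _ _ _ _ => //; clear -y_ge0 z_ge0 yz; lia.
  have [y0 z0] : dot b2 (psub p u) = 0 /\ dot b3 (psub p u) = 0.
    by clear -y_ge0 z_ge0 yz0; lia.
  have x_ge0 := nn1 p pS; rewrite y0 z0.
  have pEx : p = pnt (Z.to_nat (dot b1 (psub p u))).
    rewrite /pnt Z2Nat.id // -{1}(psubK u p) {1}pE /nrm_coords -/b1 -/b2 -/b3 y0 z0 /comb -/d1.
    move: (dot b1 _) => x.
    by move: (u) (d1) (dir2 c) (dir3 c) => [[? ?] ?] [[? ?] ?] [[? ?] ?] [[? ?] ?]; pt_ring.
  have xk : (Z.to_nat (dot b1 (psub p u)) <= k)%N by apply: kmax; rewrite -pEx.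
  have xk' : Z.to_nat (dot b1 (psub p u)) <> k by move=> xk'; apply: pq; rewrite pEx xk'.
  by clear -xk xk' x_ge0; lia.
(* Since [b1] is 1 on [d1], some normal at [q] is nonzero on [d1]; a rotation makes it the first
   one. *)
have [c' [c'q c'S a1]] : exists c', [/\ apex c' = q, cone_at S c' & dot (nrm1 c') d1 <> 0].
  have := dot_dual b1 d1 (cone_dual c0S); rewrite e11.
  case: (Z.eq_dec (dot (nrm1 c0) d1) 0) => [->|]; last by exists c0.
  case: (Z.eq_dec (dot (nrm2 c0) d1) 0) => [->|].
    case: (Z.eq_dec (dot (nrm3 c0) d1) 0) => [->|]; first by lia.
    move=> a3 _; exists (rot (rot c0)); split; [by case: (c0) c0q | | by case: (c0) a3].
    by do 2 apply: cone_at_rot.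
  move=> a2 _; exists (rot c0); split; [by case: (c0) c0q | | by case: (c0) a2].
  exact: cone_at_rot.
have fc' := cone_dual c'S; have [_ qS qS1 qS2 qS3 m1 m2 m3] := c'S.
rewrite c'q in qS qS1 qS2 qS3 m1 m2 m3 *.
have qD b i : dot b (psub (padd q i) u) = Z.of_nat k * dot b d1 + dot b i.
  exact: dot_shift_sub.
have kZ_gt0 : 0 < Z.of_nat k by clear -k_gt0; lia.
have al b : 0 <= dot b (psub u q) -> dot b d1 <= 0.
  by rewrite bq dotBr Z.sub_diag Z.sub_0_l; apply: sub_mul_nonneg.
have {}m1u := al _ (m1 _ uS); have {}m2u := al _ (m2 _ uS); have {}m3u := al _ (m3 _ uS).
have m1v i := m1 (padd u i); have m2v i := m2 (padd u i); have m3v i := m3 (padd u i).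
have vq b i : dot b (psub (padd u i) q) = dot b i - Z.of_nat k * dot b d1.
  by rewrite bq; congr (_ - _); rewrite !dotE Z.add_simpl_l.
move: (m1v _ uS2) (m2v _ uS2) (m3v _ uS2) (m1v _ uS3) (m2v _ uS3) (m3v _ uS3).
rewrite !vq => {m1v m2v m3v} be1 be2 be3 ga1 ga2 ga3.
move: (nn2 _ qS1) (nn2 _ qS2) (nn2 _ qS3) (nn3 _ qS1) (nn3 _ qS2) (nn3 _ qS3).
rewrite !qD e12 e13 !Z.mul_0_r !Z.add_0_l => y1 y2 y3 z1 z2 z3.
move: (nn1 _ qS2) (nn1 _ qS3); rewrite !qD e11 Z.mul_1_r => x2 x3.
move: (dot_dual b1 d1 fc') (dot_dual b2 d1 fc') (dot_dual b3 d1 fc').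
move: (dot_dual b2 (dir2 c) fc') (dot_dual b3 (dir2 c) fc').
move: (dot_dual b2 (dir3 c) fc') (dot_dual b3 (dir3 c) fc').
rewrite e11 e12 e13 e22 e23 e32 e33 => gy gz by_ bz ax ay az.
(* Expanded in the frame at [q], the value 0 of [b2] on [d1] is a sum of nonpositive terms. The term
   with the nonzero factor [a1] shows that [b2] vanishes on [dir1 c']; likewise for [b3]. *)
have y1E := mul_eq0_nonpos a1 m1u m2u m3u y1 y2 y3 ay.
have z1E := mul_eq0_nonpos a1 m1u m2u m3u z1 z2 z3 az.
have [[c11 c12 c13] [c21 c22 c23] [c31 c32 c33]] := dual_frame_dot fc'.
move: (dot_dual (nrm1 c') (dir1 c') fc) (dot_dual (nrm2 c') (dir1 c') fc)
  (dot_dual (nrm3 c') (dir1 c') fc).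
rewrite -/b1 -/b2 -/b3 -/d1 y1E z1E c11 c12 c13 !Z.mul_0_l !Z.add_0_r => x1a x1b x1c.
have [x1N a1N] := mul_eq1_nonpos x1a m1u.
rewrite x1N in x1b x1c.
have a2N : dot (nrm2 c') d1 = 0 by clear -x1b; lia.
have a3N : dot (nrm3 c') d1 = 0 by clear -x1c; lia.
rewrite y1E z1E a2N a3N !Z.mul_0_r ?Z.mul_0_l !Z.sub_0_r !Z.add_0_l in be2 be3 ga2 ga3 by_ bz gy gz.
have dirE d : d = comb c (nrm_coords c d) by case: fc => _ ->.
have d'1 : dir1 c' = pscale (-1) d1.
  rewrite (dirE (dir1 c')) /nrm_coords -/b1 -/b2 -/b3 x1N y1E z1E /comb -/d1.
  by move: (d1) (dir2 c) (dir3 c) => [[? ?] ?] [[? ?] ?] [[? ?] ?]; pt_ring.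
have {c' c'q c'S a1 fc' qS1 qS2 qS3 m1 m2 m3 m1u m2u m3u be1 be2 be3 ga1 ga2 ga3
  y1 y2 y3 z1 z2 z3 x2 x3 gy gz by_ bz ax ay az y1E z1E c11 c12 c13 c21 c22 c23 c31 c32 c33
  x1a x1b x1c x1N a1N a2N a3N d'1 qS} main : exists c' x2 x3,
  [/\ apex c' = q, cone_at S c', dir1 c' = pscale (-1) d1,
   0 <= Z.of_nat k + x2 /\ 0 <= Z.of_nat k + x3
   & dir2 c' = padd (dir2 c) (pscale x2 d1) /\ dir3 c' = padd (dir3 c) (pscale x3 d1)].
  have dE d x y z : dot b1 d = x -> dot b2 d = y -> dot b3 d = z -> 
    d = padd (pscale x d1) (padd (pscale y (dir2 c)) (pscale z (dir3 c))).
    by move=> <- <- <-; rewrite {1}(dirE d).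
  have := nonneg_inverse y2 y3 z2 z3 be2 be3 ga2 ga3 (esym by_) (esym bz) (esym gy) (esym gz).
  case=> [[y2E z2E y3E z3E]|[y2E z2E y3E z3E]].
    exists c', (dot b1 (dir2 c')), (dot b1 (dir3 c')); split=> //; split.
      rewrite {1}(dE (dir2 c') _ _ _ erefl y2E z2E).
      move: (dot b1 _) => x; move: (d1) (dir2 c) (dir3 c) => [[? ?] ?] [[? ?] ?] [[? ?] ?]; pt_ring.
    rewrite {1}(dE (dir3 c') _ _ _ erefl y3E z3E).
    move: (dot b1 _) => x.
    by move: (d1) (dir2 c) (dir3 c) => [[? ?] ?] [[? ?] ?] [[? ?] ?]; pt_ring.
  exists (swap c'), (dot b1 (dir3 c')), (dot b1 (dir2 c')); split=> //; first exact: cone_at_swap.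
  case: (c') y2E z2E y3E z3E => ? ? d2 d3 ? ? ? /= y2E z2E y3E z3E; split.
    rewrite {1}(dE d3 _ _ _ erefl y3E z3E).
    move: (dot b1 _) => x.
    by move: (d1) (dir2 c) (dir3 c) => [[? ?] ?] [[? ?] ?] [[? ?] ?]; pt_ring.
  rewrite {1}(dE d2 _ _ _ erefl y2E z2E).
  by move: (dot b1 _) => x; move: (d1) (dir2 c) (dir3 c) => [[? ?] ?] [[? ?] ?] [[? ?] ?]; pt_ring.
case: main => c' [x2 [x3 [c'q c'S d'1 [x2k x3k] [d'2 d'3]]]].
have [n2 n2E] : exists n, x2 = Z.of_nat n - Z.of_nat k.
  by exists (Z.to_nat (Z.of_nat k + x2)); clear -x2k; lia.
have [n3 n3E] : exists n, x3 = Z.of_nat n - Z.of_nat k.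
  by exists (Z.to_nat (Z.of_nat k + x3)); clear -x3k; lia.
have [fc' qS qS1 qS2 qS3 m1 m2 m3] := c'S.
have rowE n d : padd (padd u d) (pscale (Z.of_nat n) d1) =
    padd q (padd d (pscale (Z.of_nat n - Z.of_nat k) d1)).
  by rewrite /q /pnt; move: (u) (d) (d1) => [[? ?] ?] [[? ?] ?] [[? ?] ?]; pt_ring.
exists k, n2, n3; split; first by rewrite k_gt0 len.
- by apply: (row_length smS e11 uS2); rewrite rowE -n2E -d'2 -c'q.
- by apply: (row_length smS e11 uS3); rewrite rowE -n3E -d'3 -c'q.
have fe : dual_frame (extension c k n2 n3) by apply: dual_frame_step.
have apE : apex (extension c k n2 n3) = apex c' by rewrite c'q.
have drE : [/\ dir1 (extension c k n2 n3) = dir1 c', dir2 (extension c k n2 n3) = dir2 c'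
   & dir3 (extension c k n2 n3) = dir3 c'].
  by rewrite d'1 d'2 d'3 n2E n3E.
move: (extension _ _ _ _) fe apE drE => e fe apE [dr1 dr2 dr3].
(* Only the directions have been matched so far. Each normal is determined by its values on them, so
   the inequalities carry over. *)
have [[f11 f12 f13] [f21 f22 f23] [f31 f32 f33]] := dual_frame_dot fe.
rewrite dr1 in f11 f12 f13; rewrite dr2 in f21 f22 f23; rewrite dr3 in f31 f32 f33.
split=> //; rewrite ?apE ?dr1 ?dr2 ?dr3 // => p pS; rewrite (dot_dual _ _ fc').
- by rewrite f11 f21 f31 ?Z.mul_1_r ?Z.mul_0_r ?Z.add_0_r ?Z.add_0_l; apply: m1.
- by rewrite f12 f22 f32 ?Z.mul_1_r ?Z.mul_0_r ?Z.add_0_r ?Z.add_0_l; apply: m2.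
- by rewrite f13 f23 f33 ?Z.mul_1_r ?Z.mul_0_r ?Z.add_0_r ?Z.add_0_l; apply: m3.
Qed.

(** * Change of frame *)

Lemma combD c p q : comb c (padd p q) = padd (comb c p) (comb c q).
Proof.
case: c => u d1 d2 d3 b1 b2 b3; rewrite /comb /=.
by move: p q d1 d2 d3 => [[? ?] ?] [[? ?] ?] [[? ?] ?] [[? ?] ?] [[? ?] ?]; pt_ring.
Qed.

Lemma combZ c k p : comb c (pscale k p) = pscale k (comb c p).
Proof.
case: c => u d1 d2 d3 b1 b2 b3; rewrite /comb /=.
by move: p d1 d2 d3 => [[? ?] ?] [[? ?] ?] [[? ?] ?] [[? ?] ?]; pt_ring.
Qed.

Lemma nrm_coordsZ c k p : nrm_coords c (pscale k p) = pscale k (nrm_coords c p).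
Proof. by rewrite /nrm_coords !dotZr. Qed.

Lemma paddA p q r : padd p (padd q r) = padd (padd p q) r.
Proof. by move: p q r => [[? ?] ?] [[? ?] ?] [[? ?] ?]; pt_ring. Qed.

Lemma paddK u p : psub (padd u p) u = p.
Proof. by move: u p => [[? ?] ?] [[? ?] ?]; pt_ring. Qed.

Lemma transport_psub c p q : psub (transport c p) (transport c q) = comb c (psub p q).
Proof.
rewrite /transport /psub combD combZ.
by move: (apex c) (comb c p) (comb c q) => [[? ?] ?] [[? ?] ?] [[? ?] ?]; pt_ring.
Qed.

Lemma transport_padd c p q : transport c (padd p q) = padd (transport c p) (comb c q).
Proof. by rewrite /transport combD paddA. Qed.

Lemma transportK c : dual_frame c -> cancel (transport c) (coords c).
Proof. by case=> ck _ p; rewrite /coords /transport paddK ck. Qed.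

Lemma coordsK c : dual_frame c -> cancel (coords c) (transport c).
Proof. by case=> _ kc p; rewrite /coords /transport kc psubK. Qed.

(** [push] and [pull] act on functionals, as the transposes of [comb] and [nrm_coords]. *)
Definition push (c : frame) (b : pt) : pt :=
  (dot b (dir1 c), dot b (dir2 c), dot b (dir3 c)).

Lemma dot_push c b p : dot (push c b) p = dot b (comb c p).
Proof. by case: p => [[x y] z]; rewrite /comb !dotE /push /=; lia. Qed.

Definition pull (c : frame) (b : pt) : pt :=
  let: (x, y, z) := b in
  padd (pscale x (nrm1 c)) (padd (pscale y (nrm2 c)) (pscale z (nrm3 c))).

Lemma dot_pull c b p : dot (pull c b) p = dot b (nrm_coords c p).
Proof. by case: b => [[x y] z]; rewrite /pull !dotE /nrm_coords /=; lia. Qed.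

Definition comp_frame (a c : frame) : frame :=
  Frame (transport a (apex c)) (comb a (dir1 c)) (comb a (dir2 c)) (comb a (dir3 c))
    (pull a (nrm1 c)) (pull a (nrm2 c)) (pull a (nrm3 c)).

Lemma comb_comp a c p : comb (comp_frame a c) p = comb a (comb c p).
Proof.
case: p => [[x y] z].
have combE b : comb b (x, y, z) =
  padd (pscale x (dir1 b)) (padd (pscale y (dir2 b)) (pscale z (dir3 b))) by [].
by rewrite !combE !(combD, combZ).
Qed.

Lemma nrm_coords_comp a c p :
  nrm_coords (comp_frame a c) p = nrm_coords c (nrm_coords a p).
Proof. by rewrite {1}/nrm_coords /= !dot_pull. Qed.

Lemma dual_comp a c : dual_frame a -> dual_frame c -> dual_frame (comp_frame a c).
Proof.
by move=> [ak ka] [ck kc]; split=> p; rewrite comb_comp nrm_coords_comp ?ak ?ck ?kc ?ka.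
Qed.

Lemma transport_comp a c p : transport (comp_frame a c) p = transport a (transport c p).
Proof. by rewrite {1}/transport comb_comp -transport_padd. Qed.

Lemma coords_comp a c p : dual_frame a ->
  coords (comp_frame a c) p = coords c (coords a p).
Proof.
move=> fa; rewrite /coords nrm_coords_comp; congr nrm_coords.
by rewrite -{1}(coordsK fa p) transport_psub; case: fa => ->.
Qed.

(** [coords c] is again an affine unimodular map; its frame is read off from the images of the
    origin and of the unit vectors. *)
Definition inv_frame (c : frame) : frame :=
  Frame (coords c (0, 0, 0))
    (nrm_coords c (1, 0, 0)) (nrm_coords c (0, 1, 0)) (nrm_coords c (0, 0, 1))
    (push c (1, 0, 0)) (push c (0, 1, 0)) (push c (0, 0, 1)).

Lemma comb_inv c p : comb (inv_frame c) p = nrm_coords c p.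
Proof.
case: c p => ? ? ? ? b1 b2 b3 [[x y] z]; rewrite /comb /nrm_coords /=.
by move: b1 b2 b3 => [[? ?] ?] [[? ?] ?] [[? ?] ?]; pt_ring.
Qed.

Lemma nrm_coords_inv c p : nrm_coords (inv_frame c) p = comb c p.
Proof.
transitivity (dot (push c (1, 0, 0)) p, dot (push c (0, 1, 0)) p, dot (push c (0, 0, 1)) p) => //.
by rewrite !dot_push; case: (comb c p) => [[x y] z]; apply: pt_eq; pt_ring.
Qed.

Lemma dual_inv c : dual_frame c -> dual_frame (inv_frame c).
Proof. by case=> ck kc; split=> p; rewrite comb_inv nrm_coords_inv ?ck ?kc. Qed.

Lemma transport_inv c p : transport (inv_frame c) p = coords c p.
Proof.
rewrite /transport comb_inv; case: c => u d1 d2 d3 b1 b2 b3.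
cbv beta iota delta [apex inv_frame coords nrm_coords nrm1 nrm2 nrm3].
by move: p u b1 b2 b3 => [[? ?] ?] [[? ?] ?] [[? ?] ?] [[? ?] ?] [[? ?] ?]; pt_ring.
Qed.

Lemma pull_inv c b : pull (inv_frame c) b = push c b.
Proof.
case: c b => ? d1 d2 d3 ? ? ? [[x y] z].
cbv beta iota delta [pull push inv_frame dir1 dir2 dir3 nrm1 nrm2 nrm3].
by move: d1 d2 d3 => [[? ?] ?] [[? ?] ?] [[? ?] ?]; pt_ring.
Qed.

Definition std_frame : frame :=
  Frame (0, 0, 0) (1, 0, 0) (0, 1, 0) (0, 0, 1) (1, 0, 0) (0, 1, 0) (0, 0, 1).

Lemma comp_inv_frame c : dual_frame c -> comp_frame (inv_frame c) c = std_frame.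
Proof.
move=> fc; have [e1 e2 e3] := dual_frame_dot fc.
rewrite /comp_frame !comb_inv !pull_inv transport_inv /coords e1 e2 e3 /push.
have -> : psub (apex c) (apex c) = (0, 0, 0).
  by case: (apex c) => [[? ?] ?]; pt_ring.
case: e1 => -> -> ->; case: e2 => -> -> ->; case: e3 => -> -> ->.
by congr Frame; rewrite /nrm_coords;
  move: (nrm1 c) (nrm2 c) (nrm3 c) => [[? ?] ?] [[? ?] ?] [[? ?] ?]; pt_ring.
Qed.

Lemma cone_at_map S a c : dual_frame a -> cone_at S c ->
  cone_at (map (transport a) S) (comp_frame a c).
Proof.
move=> fa [fc uS uS1 uS2 uS3 n1 n2 n3].
have np b p : 0 <= dot b (psub p (apex c)) ->
    0 <= dot (pull a b) (psub (transport a p) (transport a (apex c))).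
  by rewrite transport_psub dot_pull; case: fa => ->.
split; rewrite /= -?transport_padd; try exact: map_f.
- exact: dual_comp.
- by move=> _ /mapP[p pS ->]; apply/np/n1.
- by move=> _ /mapP[p pS ->]; apply/np/n2.
- by move=> _ /mapP[p pS ->]; apply/np/n3.
Qed.

Lemma smooth_points_map m S a : dual_frame a -> smooth_points m S ->
  smooth_points m (map (transport a) S).
Proof.
move=> fa [szS cvS cnS]; have a_inj := can_inj (transportK fa).
split; first by rewrite size_map.
- move=> _ d n t /mapP[p pS ->]; have -> : d = comb a (nrm_coords a d) by case: fa => _ ->.
  rewrite -!combZ -!transport_padd !mem_map //; exact: cvS.
- move=> _ f /mapP[u uS ->] fu; have [||c cu cS] := cnS u (push a f) => //.
    move=> p pS pu; rewrite dot_push -transport_psub; apply: fu; first exact: map_f.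
    by move/a_inj.
  by exists (comp_frame a c); [rewrite /= cu | apply: cone_at_map].
Qed.

(** * Existence of a vertex *)

Lemma exists_min (T : eqType) (g : T -> Z) (s : seq T) : s != [::] ->
  exists2 u, u \in s & forall p, p \in s -> g u <= g p.
Proof.
elim: s => // x s IHs _; have [->|/IHs [u us umin]] := eqVneq s [::].
  by exists x; rewrite ?mem_head // => p; rewrite inE => /eqP ->; lia.
have [le|lt] := Z.le_gt_cases (g u) (g x).
  by exists u; rewrite ?inE ?us ?orbT // => p /orP[/eqP -> //|/umin].
exists x; rewrite ?mem_head // => p; rewrite inE => /orP[/eqP ->|/umin]; lia.
Qed.

(** Uniqueness of signed digits in base [K]: the lowest digit would be a multiple of [K] smaller
    than [K]. *)
Lemma lex_inj K x y z : Z.abs x < K -> Z.abs y < K -> Z.abs z < K ->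
  K * K * x + K * y + z = 0 -> [/\ x = 0, y = 0 & z = 0].
Proof.
have small a b : Z.abs b < K -> K * a + b = 0 -> a = 0 by nia.
move=> xK yK zK e; have y_ : K * x + y = 0 by apply: (small _ z) => //; lia.
have x0 := small x y yK y_; move: e y_; rewrite x0 => e y_.
by split=> //; lia.
Qed.

(** A functional that is injective on [S] has a unique minimum, which [points_cone] turns into a
    cone. *)
Lemma exists_cone m S : smooth_points m S -> S != [::] -> exists c, cone_at S c.
Proof.
move=> smS S0.
have [M SM] := upper_bound (fun p : pt => Z.abs p.1.1 + Z.abs p.1.2 + Z.abs p.2) S.
(* Coordinates of points of [S] differ by less than [2 * M], so [(K * K, K, 1)] reads the
   differences as digits. *)
have [K KE] : exists K, K = 2 * M by exists (2 * M).
pose f : pt := (K * K, K, 1).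
have [u uS umin] := exists_min (dot f) S0.
have [|c _ cS] := points_cone smS (f := f) uS; last by exists c.
move=> p pS pu; rewrite dotBr; suff : dot f p <> dot f u by have := umin p pS; lia.
move=> fpu; apply: pu; move: (SM p pS) (SM u uS) fpu; rewrite /f /dot.
case: p u {pS uS umin} => [[x y] z] [[x' y'] z'] h h' e; rewrite /= in h h'.
have [] : [/\ x - x' = 0, y - y' = 0 & z - z' = 0] by apply: (@lex_inj K); lia.
by move=> ? ? ?; apply: pt_eq; lia.
Qed.

(** * The search *)

Notation halfspace := (pt * Z)%type.
Notation poly := (seq pt * seq halfspace)%type.

Definition sat (p : pt) (h : halfspace) : bool := Z.leb h.2 (dot h.1 p).

Fixpoint insert_row (p d : pt) (n : nat) (L : seq pt) : seq pt :=
  let L' := if pmem p L then L else p :: L in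
  if n is n'.+1 then insert_row (padd p d) d n' L' else L'.

(** Detects an edge already reached from its other end, at [c], so that the search does not walk
    around the polytope forever. *)
Definition ends_at (e c : frame) : bool :=
  let k := dot (nrm1 e) (psub (apex c) (apex e)) in
  if pt_eqb (apex c) (padd (apex e) (pscale k (dir1 e))) then
    if Z.ltb 0 k then pmem (pscale (-1) (dir1 e)) [:: dir1 c; dir2 c; dir3 c] else false
  else false.

Definition transport_halfspace (c : frame) (h : halfspace) : halfspace :=
  let b := pull c h.1 in (b, h.2 + dot b (apex c)).

Definition halfspace_eqb (h h' : halfspace) : bool :=
  if pt_eqb h.1 h'.1 then Z.eqb h.2 h'.2 else false.

(** Every listed polytope has the standard cone at the origin, so an affine unimodular map onto the
    unknown polytope sends that cone to one of the cones found, with its edges in one of six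
    orders. *)
Definition reorderings (c : frame) : seq frame :=
  [:: c; rot c; rot (rot c); swap c; rot (swap c); rot (rot (swap c))].

(** Half-spaces can be compared literally because the normals on both sides are primitive. *)
Definition fits (Q : poly) (H : seq halfspace) (L : seq pt) (c : frame) : bool :=
  if allb (fun v => pmem (transport c v) L) Q.1 then
    allb (fun h => hasb (halfspace_eqb (transport_halfspace c h)) H) Q.2
  else false.

Definition recognized (Qs : seq poly) (C : seq frame) (H : seq halfspace) (L : seq pt) : bool :=
  hasb (fun Q : poly =>
    if Nat.eqb (size Q.1) (size C) then
      hasb (fun c => hasb (fits Q H L) (reorderings c)) C
    else false) Qs.

(* Explores all ways of following the edges in [E], given the known vertex
   cones [C], valid inequalities [H] and lattice points [L] of a polytope with
   at most [m] lattice points.  The edge starting along [dir1 e] has length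
   [k], and the neighbouring facets determine the frame at its other end up to
   the lengths [n] and [n'] of the parallel rows through the points
   [apex e + dir2 e] and [apex e + dir3 e]. *)
Fixpoint search (m : nat) (Qs : seq poly) (fuel : nat)
    (C : seq frame) (H : seq halfspace) (L : seq pt) (E : seq frame) : bool :=
  if fuel is fuel'.+1 then
  match E with
  | [::] => recognized Qs C H L
  | e :: E' =>
    if hasb (ends_at e) C then search m Qs fuel' C H L E' else
    allb (fun k =>
      if allb (sat (padd (apex e) (pscale (Z.of_nat k) (dir1 e)))) H then
      let L1 := insert_row (apex e) (dir1 e) k L in
      if Nat.leb (size L1) m then
      allb (fun n =>
        let u2 := padd (apex e) (dir2 e) in
        if allb (sat (padd u2 (pscale (Z.of_nat n) (dir1 e)))) H then
        let L2 := insert_row u2 (dir1 e) n L1 in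
        if Nat.leb (size L2) m then
        allb (fun n' =>
          let u3 := padd (apex e) (dir3 e) in
          if allb (sat (padd u3 (pscale (Z.of_nat n') (dir1 e)))) H then
          let L3 := insert_row u3 (dir1 e) n' L2 in
          if Nat.leb (size L3) m then
            let c := extension e k n n' in
            let h := (nrm1 c, dot (nrm1 c) (apex c)) in
            if allb (fun p => sat p h) L3 then
              search m Qs fuel' (c :: C) (h :: H) L3 (rot c :: rot (rot c) :: E')
            else true
          else true else true) (iota 0 m)
        else true else true) (iota 0 m)
      else true else true) (iota 1 m.-1)
  end else false.

Definition realizes (S : seq pt) (Q : poly) (c : frame) : Prop :=
  [/\ dual_frame c, forall v, v \in Q.1 -> transport c v \in S
    & forall p h, p \in S -> h \in Q.2 -> sat (coords c p) h].

Lemma halfspace_eqbP h h' : halfspace_eqb h h' -> h = h'.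
Proof.
case: h h' => [b m] [b' m']; rewrite /halfspace_eqb /=.
by case: ifP => // /pt_eqbP -> /Z.eqb_eq ->.
Qed.

Section SearchSound.

Variables (m : nat) (S : seq pt) (smS : smooth_points m S).

Definition known_points (L : seq pt) : Prop := uniq L /\ {subset L <= S}.

Definition valid_halfspaces (H : seq halfspace) : Prop :=
  forall h, List.In h H -> forall p, p \in S -> sat p h.

Definition cones (C : seq frame) : Prop := forall c, List.In c C -> cone_at S c.

Lemma known_points_row p d n L : known_points L ->
  p \in S -> padd p (pscale (Z.of_nat n) d) \in S -> known_points (insert_row p d n L).
Proof.
have shift q t : padd (padd q d) (pscale (Z.of_nat t) d) = padd q (pscale (Z.of_nat t.+1) d).
  by rewrite Nat2Z.inj_succ -Z.add_1_r; move: q d => [[? ?] ?] [[? ?] ?]; pt_ring.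
move=> knL pS; elim: n => [|n IHn] in p L knL pS * => /= qS.
  case: ifP => // /negbT; rewrite pmemE => pL; case: knL => uL LS; split => /=.
    by rewrite pL.
  by move=> q; rewrite inE => /orP[/eqP -> //|/LS].
apply: IHn; rewrite ?shift //; last first.
  by have := points_convex smS (n := n.+1) (t := 1%N) pS qS isT; rewrite pscale1.
case: ifP => // /negbT; rewrite pmemE => pL; case: knL => uL LS; split => /=.
  by rewrite pL.
by move=> q; rewrite inE => /orP[/eqP -> //|/LS].
Qed.

Lemma known_points_size L : known_points L -> Nat.leb (size L) m.
Proof.
case=> uL LS; apply/Nat.leb_le/ssrnat.leP; apply: leq_trans (points_size smS).
exact: uniq_leq_size.
Qed.

Lemma cone_at_reordering c c' : cone_at S c -> List.In c' (reorderings c) -> cone_at S c'.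
Proof.
move=> cS; have r2 x : cone_at S x -> cone_at S (rot (rot x)).
  by move=> ?; do 2 apply: cone_at_rot.
have sS := cone_at_swap cS.
case=> [<- //|[<-|[<-|[<- //|[<-|[<-|[]]]]]]]; by [apply: cone_at_rot | apply: r2].
Qed.

Lemma recognized_sound Qs C H L : cones C -> valid_halfspaces H ->
  {subset L <= S} -> recognized Qs C H L ->
  exists Q c, List.In Q Qs /\ realizes S Q c.
Proof.
move=> CS HS LS /hasbP [Q QQs]; case: ifP => // _ /hasbP [c0 /CS c0S].
move=> /hasbP [c /(cone_at_reordering c0S) cS]; rewrite /fits; case: ifP => // /allbP QL /allbP QH.
exists Q, c; split=> //; split; first exact: cone_dual cS.
  by move=> v /In_mem /QL /pmemP /LS.
move=> p h pS /In_mem /QH /hasbP [h' h'H /halfspace_eqbP hh'].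
move: (HS _ h'H _ pS); rewrite -hh' /sat /transport_halfspace => /Z.leb_le /= hp.
apply/Z.leb_le; rewrite /coords -dot_pull dotBr.
by move: (dot _ _) (dot _ _) hp => x y; lia.
Qed.

(** By [edge_step] the lengths that occur in [S] are among those tried. On that branch no test
    prunes, as all inserted points lie in [S] and all half-spaces contain [S]; the answer [true]
    therefore comes from a recognized leaf. *)
Lemma search_sound Qs fuel C H L E :
  cones C -> valid_halfspaces H -> known_points L -> cones E ->
  search m Qs fuel C H L E -> exists Q c, List.In Q Qs /\ realizes S Q c.
Proof.
elim: fuel => //= fuel IH in C H L E *; case: E => [|e E] CS HS LS ES.
  by apply: recognized_sound => //; case: LS.
case: ifP => _; first by apply: IH => // c cE; apply: ES; right.
have eS : cone_at S e by apply: ES; left.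
have [k [n [n' [/andP[k_gt0 km] nm n'm cS]]]] := edge_step smS eS.
have iota_In i : (i < m)%N -> List.In i (iota 0 m) by move=> im; apply/In_mem; rewrite mem_iota.
have validb p : p \in S -> allb (sat p) H by move=> pS; apply/allbP => h hH; apply: HS.
have [fc qS q1S q2S q3S n1 n2 n3] := cS; have [_ uS u1S u2S u3S _ _ _] := eS.
have rowE d : padd (padd (apex e) d) (pscale (Z.of_nat n) (dir1 e)) =
    padd (apex (extension e k n n')) (padd d (pscale (Z.of_nat n - Z.of_nat k) (dir1 e))).
  by rewrite /=; move: (apex e) d (dir1 e) => [[? ?] ?] [[? ?] ?] [[? ?] ?]; pt_ring.
have rowE' d : padd (padd (apex e) d) (pscale (Z.of_nat n') (dir1 e)) =
    padd (apex (extension e k n n')) (padd d (pscale (Z.of_nat n' - Z.of_nat k) (dir1 e))).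
  by rewrite /=; move: (apex e) d (dir1 e) => [[? ?] ?] [[? ?] ?] [[? ?] ?]; pt_ring.
move=> /allbP /(_ k); have -> : List.In k (iota 1 m.-1) <-> True.
  by split=> // _; apply/In_mem; rewrite mem_iota; case: (m) km k_gt0 => //= ? ?; lia.
move=> /(_ I); rewrite validb //.
have kn1 := known_points_row LS uS qS; rewrite known_points_size // {LS}.
move=> /allbP /(_ n (iota_In _ nm)); rewrite rowE validb //.
have kn2 : known_points
    (insert_row (padd (apex e) (dir2 e)) (dir1 e) n (insert_row (apex e) (dir1 e) k L)).
  by apply: known_points_row; rewrite // rowE.
rewrite known_points_size //.
move=> /allbP /(_ n' (iota_In _ n'm)); rewrite rowE' validb //.
have kn3 := known_points_row (d := dir1 e) (n := n') kn2 u3S.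
rewrite rowE' in kn3; have {}kn3 := kn3 q3S.
rewrite known_points_size //.
have hS p : p \in S -> sat p (nrm1 (extension e k n n'),
    dot (nrm1 (extension e k n n')) (apex (extension e k n n'))).
  move=> pS; apply/Z.leb_le; have := n1 _ pS; rewrite dotBr.
  by move: (dot _ _) (dot _ _) => x y /=; lia.
case: allbP => [_|[]]; last by move=> p /In_mem pL; apply: hS; case: kn3 => _; apply.
apply: IH => //.
- by move=> c [<- //|/CS].
- by move=> h [<- //|/HS].
- move=> c [<-|[<-|cE]]; [exact: cone_at_rot | by do 2 apply: cone_at_rot |].
  by apply: ES; right.
Qed.

End SearchSound.

Definition simplex (n : Z) : poly :=
  ([:: (0, 0, 0); (n, 0, 0); (0, n, 0); (0, 0, n)],
   [:: ((1, 0, 0), 0); ((0, 1, 0), 0); ((0, 0, 1), 0); ((-1, -1, -1), - n)]).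

(* Lattice polygons: vertices, and triples [(a, b, m)] for [m <= a x + b y]. *)
Notation polygon := (seq (Z * Z) * seq (Z * Z * Z))%type.

Definition triangle (n : Z) : polygon :=
  ([:: (0, 0); (n, 0); (0, n)], [:: (1, 0, 0); (0, 1, 0); (-1, -1, - n)]).

Definition trapezoid (a s : Z) : polygon :=
  ([:: (0, 0); (a + s, 0); (0, 1); (a, 1)],
   [:: (1, 0, 0); (0, 1, 0); (0, -1, -1); (-1, - s, - (a + s))]).

(* The points over a polygon of height between [0] and [l + a x + b y]. *)
Definition tower (B : polygon) (l a b : Z) : poly :=
  ([seq (v.1, v.2, 0) | v <- B.1] ++ [seq (v.1, v.2, l + a * v.1 + b * v.2) | v <- B.1],
   ((0, 0, 1), 0) :: ((a, b, -1), - l) :: [seq ((h.1.1, h.1.2, 0), h.2) | h <- B.2]).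

(* Twice the unit simplex, truncated at a vertex. *)
Definition truncated_simplex : poly :=
  ([:: (0, 0, 0); (2, 0, 0); (0, 2, 0); (0, 0, 1); (1, 0, 1); (0, 1, 1)],
   [:: ((1, 0, 0), 0); ((0, 1, 0), 0); ((0, 0, 1), 0); ((-1, -1, -1), -2); ((0, 0, -1), -1)]).

(** [a], [b], [c] are the heights over the vertices of the unit triangle, so there are
    [a + b + c + 3] lattice points. *)
Definition prism (h : Z * Z * Z) : poly :=
  let: (a, b, c) := h in tower (triangle 1) a (b - a) (c - a).

Definition polys4 : seq poly := [:: simplex 1; simplex 2].

(** The triples are all [1 <= a <= b <= c] with [a + b + c <= 9], that is, at most 12 lattice
    points. The truncated simplex has 9, and the product of the doubled triangle with a segment has
    12. *)
Definition polys6 : seq poly :=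
  [:: truncated_simplex, tower (triangle 2) 1 0 0 &
      map prism [:: (1, 1, 1); (1, 1, 2); (1, 1, 3); (1, 1, 4); (1, 1, 5); (1, 1, 6);
        (1, 1, 7); (1, 2, 2); (1, 2, 3); (1, 2, 4); (1, 2, 5); (1, 2, 6); (1, 3, 3);
        (1, 3, 4); (1, 3, 5); (1, 4, 4); (2, 2, 2); (2, 2, 3); (2, 2, 4); (2, 2, 5);
        (2, 3, 3); (2, 3, 4); (3, 3, 3)]].

(** Combinatorial cubes with 8, 12, 10, 12, 12 and 12 lattice points in this order; the first is the
    unit cube. *)
Definition polys8 : seq poly :=
  [:: tower (trapezoid 1 0) 1 0 0; tower (trapezoid 2 0) 1 0 0;
      tower (trapezoid 1 1) 1 0 0; tower (trapezoid 1 2) 1 0 0;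
      tower (trapezoid 1 0) 1 1 1; tower (trapezoid 1 1) 1 0 1].

Definition polys : seq poly := polys4 ++ polys6 ++ polys8.

(** Pruned branches count as [true] and exhausted fuel as [false], so the computation also certifies
    that depth 40 suffices. *)
Lemma search_complete :
  search 12 polys 40 [:: std_frame] [:: ((1, 0, 0), 0); ((0, 1, 0), 0); ((0, 0, 1), 0)]
    [:: (0, 0, 0); (1, 0, 0); (0, 1, 0); (0, 0, 1)]
    [:: std_frame; rot std_frame; rot (rot std_frame)].
Proof. by vm_compute. Qed.

Theorem smooth_points_classification S : smooth_points 12 S -> S != [::] ->
  exists Q c, Q \in polys /\ realizes S Q c.
Proof.
move=> smS /(exists_cone smS) [a aS]; have fa := cone_dual aS; have fi := dual_inv fa.
have smT := smooth_points_map fi smS.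
have := cone_at_map fi aS; rewrite comp_inv_frame //.
set T := map _ S in smT * => eT; have [_ uT u1T u2T u3T n1 n2 n3] := eT.
have [||||Q [c [/In_mem QQs [fc QT TQ]]]] := search_sound smT _ _ _ _ search_complete.
- by move=> c [<- //|[]].
- move=> h hH p pT; apply/Z.leb_le; move: (n1 p pT) (n2 p pT) (n3 p pT); rewrite !dotBr /=.
  by case: hH => [<-|[<-|[<-|[]]]] /=; lia.
- by split=> // p; rewrite !inE => /or4P[] /eqP ->.
- by move=> c [<-|[<-|[<-|[]]]] //; do ?apply: cone_at_rot.
exists Q, (comp_frame a c); split=> //; split; first exact: dual_comp.
- move=> v /QT /mapP[p pS e]; rewrite transport_comp e transport_inv.
  by rewrite coordsK.
- move=> p h pS hQ; rewrite coords_comp // -(transport_inv a); apply: TQ => //; exact: map_f.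
Qed.

(** * Extreme rays *)

Lemma count_lt (T : eqType) (a b : pred T) (s : seq T) x :
  {in s, forall y, a y -> b y} -> x \in s -> b x -> ~~ a x -> (count a s < count b s)%N.
Proof.
move=> ab + bx nax; elim: s ab => //= y s IHs ab.
have {}IHs : x \in s -> (count a s < count b s)%N.
  by apply: IHs => z zs; apply: ab; rewrite inE zs orbT.
have le_ab : (count a s <= count b s)%N.
  elim: s ab {IHs} => //= z s IHs ab; rewrite leq_add //.
    by have := ab z; rewrite !inE eqxx orbT => /(_ isT); case: (a z) => // ->.
  by apply: IHs => t; rewrite inE => ts; apply: ab; rewrite !inE orbCA ts orbT.
rewrite inE => /orP[/eqP <-|/IHs lt_ab]; first by rewrite bx (negbTE nax) add0n add1n ltnS.
rewrite -addnS leq_add //; have := ab y; rewrite inE eqxx => /(_ isT).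
by case: (a y) => // ->.
Qed.

(** The ratio test of the simplex method: fractions with positive denominators, compared by
    cross-multiplication. *)
Lemma exists_min_ratio (T : eqType) (num den : T -> Z) (s : seq T) x :
  x \in s -> 0 < den x -> exists y, [/\ y \in s, 0 < den y
    & forall z, z \in s -> 0 < den z -> num y * den z <= num z * den y].
Proof.
elim: s x => // t s IHs x xs dx.
have tP : 0 < den t -> forall y, y = t -> num t * den y <= num y * den t.
  by move=> _ y ->; lia.
have [/hasP[x' x's /Z.ltb_lt dx']|/hasPn no] := boolP (has (fun x => 0 <? den x) s).
  have [y [ys dy ymin]] := IHs x' x's dx'.
  have [dt|dt] := Z.lt_ge_cases 0 (den t); last first.
    exists y; split=> //; first by rewrite inE ys orbT.
    by move=> z; rewrite inE => /orP[/eqP -> ?|/ymin //]; lia.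
  have [le|lt] := Z.le_gt_cases (num y * den t) (num t * den y).
    exists y; split=> //; first by rewrite inE ys orbT.
    by move=> z; rewrite inE => /orP[/eqP -> //|/ymin].
  exists t; split=> //; first exact: mem_head.
  move=> z; rewrite inE => /orP[/eqP -> _|zs dz]; first by lia.
  by have := ymin z zs dz; nia.
have {}no z : z \in s -> ~ 0 < den z by move=> /no /negP nz dz; apply: nz; apply/Z.ltb_lt.
move: xs; rewrite inE => /orP[/eqP xt|/no //]; exists x; split=> //.
  by rewrite xt mem_head.
by move=> z; rewrite inE => /orP[/eqP ->|/no //]; rewrite xt; lia.
Qed.

(* A functional that is nonnegative on [T], negative at [(1, 0, 0)], and tight
   at as many points of [T] as possible spans an extreme ray of the cone dual to
   [T]: otherwise it could be moved along a functional [w] that vanishes at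
   [(1, 0, 0)] and at all the tight points until one more point is tight. *)
Lemma missing_edge (T : seq pt) :
  (forall t, t \in T -> [/\ 0 <= t.1.1, 0 <= t.1.2 & 0 <= t.2]) ->
  (forall k, 0 < k -> (k, 0, 0) \notin T) ->
  (forall w, (forall t, t \in T -> dot w t = 0) -> w = (0, 0, 0)) ->
  exists v t t', [/\ v.1.1 < 0, forall s, s \in T -> 0 <= dot v s,
    t \in T /\ t' \in T, dot v t = 0 /\ dot v t' = 0 & t.1.2 * t'.2 <> t.2 * t'.1.2].
Proof.
move=> T_ge0 T_edge T_span; pose tight v t := dot v t =? 0.
have [M TM] := upper_bound (fun t : pt => t.1.1) T.
pose good (v : pt) := v.1.1 < 0 /\ forall s, s \in T -> 0 <= dot v s.
(* If [y + z > 0], then [x < M] makes the value nonnegative; if [y = z = 0], then [x <= 0] because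
   no point lies on the positive first axis. *)
have : good (-1, Z.max M 0, Z.max M 0).
  split=> // t tT; have [x0 y0 z0] := T_ge0 t tT; have := TM t tT.
  case: t tT x0 y0 z0 => [[x y] z] tT x0 y0 z0 xM; rewrite /= in x0 y0 z0 xM.
  have [yz|yz] := Z.le_gt_cases (y + z) 0; last first.
    have := Z.le_max_l M 0; have := Z.le_max_r M 0; move: (Z.max M 0) => K K0 MK.
    rewrite /dot; clear -x0 xM yz K0 MK; nia.
  have [y_ z_] : y = 0 /\ z = 0 by lia.
  rewrite /dot y_ z_ in tT *; have [/T_edge|] := Z.lt_ge_cases 0 x; first by rewrite tT.
  by clear; lia.
move: (-1, Z.max M 0, Z.max M 0) => v0.
(* Each move makes at least one more point tight, so the number of points that are not tight
   decreases. *)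
have [n] := ubnP (size T - count (tight v0) T); elim: n v0 => // n IH v le_n [vx v_ge0].
have [/hasP[t tT /hasP[t' t'T /and3P[/Z.eqb_eq vt /Z.eqb_eq vt' /negP tt']]]|] :=
  boolP (has (fun t => has (fun t' =>
    [&& tight v t, tight v t' & ~~ (t.1.2 * t'.2 =? t.2 * t'.1.2)]) T) T).
  by exists v, t, t'; split=> // tt; apply: tt'; apply/Z.eqb_eq.
move=> /hasPn par.
have {}par t t' : t \in T -> t' \in T -> dot v t = 0 -> dot v t' = 0 -> t.1.2 * t'.2 = t.2 * t'.1.2.
  move=> tT t'T /Z.eqb_eq vt /Z.eqb_eq vt'; have /hasPn/(_ t' t'T) := par t tT.
  by rewrite /tight vt vt' /= negbK => /Z.eqb_eq.
(* The [(y, z)]-parts of the tight points are all parallel. A right-angle turn of a nonzero one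
   gives [w]; if all are zero, [(0, 1, 0)] does. *)
have [w [w0 wx wt]] : exists w, [/\ w <> (0, 0, 0), w.1.1 = 0
    & forall t, t \in T -> dot v t = 0 -> dot w t = 0].
  have [/hasP[t tT /andP[/Z.eqb_eq vt /negP t0]]|/hasPn no] :=
    boolP (has (fun t => tight v t && ~~ ((t.1.2 =? 0) && (t.2 =? 0))) T).
    exists (0, - t.2, t.1.2); split=> // [[t2 t1]|t' t'T vt'].
      by apply: t0; apply/andP; split; apply/Z.eqb_eq; lia.
    have := par t t' tT t'T vt vt'; move: t t' {tT vt t0 t'T vt'} => [[? ?] ?] [[? ?] ?].
    by rewrite /dot /=; lia.
  exists (0, 1, 0); split=> // t tT /Z.eqb_eq vt; have := no t tT.
  rewrite /tight vt /= negbK => /andP[/Z.eqb_eq t1 _].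
  by move: t1; case: (t) => [[x y] z] t1; rewrite /= in t1; rewrite /dot t1; clear; lia.
have {w w0 wx wt} [w [s0 [s0T ws0 wx wt]]] : exists w s0, [/\ s0 \in T, 0 < - dot w s0, w.1.1 = 0
    & forall t, t \in T -> dot v t = 0 -> dot w t = 0].
  have [/hasP[s sT /negP ws]|/hasPn no] := boolP (has (fun s => ~~ (dot w s =? 0)) T); last first.
    by case: w0; apply: T_span => t /no; rewrite negbK => /Z.eqb_eq.
  have [neg|pos] := Z.lt_ge_cases (dot w s) 0; first by exists w, s; split=> //; lia.
  exists (pscale (-1) w), s; split=> //.
  - have ws0 : dot w s <> 0 by move=> e; apply: ws; apply/Z.eqb_eq.
    by rewrite dotZl; clear -ws0 pos; lia.
  - by case: (w) wx => [[? ?] ?] /= ->.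
  - by move=> t tT vt; rewrite dotZl wt.
have [s [sT ws s_min]] := exists_min_ratio (dot v) (den := fun t => - dot w t) s0T ws0.
(* This is [v] moved along [w] until the first point [s] becomes tight, with denominators
   cleared. *)
pose v' := padd (pscale (- dot w s) v) (pscale (dot v s) w).
have v'E t : dot v' t = - dot w s * dot v t + dot v s * dot w t by rewrite /v' !dotE.
apply: (IH v').
  have lt_count : (count (tight v) T < count (tight v') T)%N.
    apply: (count_lt (x := s)) => //.
    - by move=> t tT /Z.eqb_eq vt; rewrite /tight v'E (wt t tT vt) vt !Z.mul_0_r.
    - by rewrite /tight v'E; apply/Z.eqb_eq; ring.
    - by apply/negP => /Z.eqb_eq /(wt s sT); clear -ws; lia.
  have := count_size (tight v') T; move: (count _ _) (count _ _) (size T) le_n lt_count.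
  by clear; lia.
split.
  have -> : v'.1.1 = - dot w s * v.1.1 + dot v s * w.1.1.
    by rewrite /v'; move: (- dot w s) (dot v s) (v) (w) => a b [[? ?] ?] [[? ?] ?].
  by rewrite wx; clear -ws vx; nia.
move=> t tT; rewrite v'E; have := v_ge0 t tT; have := v_ge0 s sT.
have [neg|pos] := Z.lt_ge_cases (dot w t) 0; last by clear -ws pos; nia.
have := s_min t tT; clear -neg; lia.
Qed.

(** * The 33 polytopes *)

Definition cross (p q : pt) : pt :=
  let: (x, y, z) := p in let: (x', y', z') := q in
  (y * z' - z * y', z * x' - x * z', x * y' - y * x').

Definition det (p q r : pt) : Z := dot p (cross q r).

Definition inside (Q : poly) (p : pt) : bool := allb (sat p) Q.2.

(* The cone at a vertex [v], if exactly three facets meet there; a junk value otherwise. *)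
Definition corner (Q : poly) (v : pt) : frame :=
  match filter (fun h => Z.eqb (dot h.1 v) h.2) Q.2 with
  | [:: h1; h2; h3] =>
    let: (b1, b2, b3) := (h1.1, h2.1, h3.1) in
    let d := det b1 b2 b3 in
    (* Cramer's rule: if [d] is 1 or -1, multiplying by [d] is dividing by it. Any other determinant
       is rejected by [check_dual]. *)
    Frame v (pscale d (cross b2 b3)) (pscale d (cross b3 b1)) (pscale d (cross b1 b2)) b1 b2 b3
  | _ => std_frame
  end.

Definition basis : seq pt := [:: (1, 0, 0); (0, 1, 0); (0, 0, 1)].

Definition check_dual (c : frame) : bool :=
  allb (fun e => if pt_eqb (nrm_coords c (comb c e)) e
                 then pt_eqb (comb c (nrm_coords c e)) e else false) basis.

Definition dirs (c : frame) : seq pt := [:: dir1 c; dir2 c; dir3 c].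

Definition nrms (c : frame) : seq pt := [:: nrm1 c; nrm2 c; nrm3 c].

Definition bound (V : seq pt) (e : pt) : Z := foldr (fun v m => Z.max (dot e v) m) 0 V.

Definition interval (m : Z) : seq Z := [seq Z.of_nat i | i <- iota 0 (Z.to_nat m).+1].

Definition lattice_points (Q : poly) : seq pt :=
  filter (inside Q)
    (flatten [seq flatten [seq [seq (x, y, z) | z <- interval (bound Q.1 (0, 0, 1))]
                          | y <- interval (bound Q.1 (0, 1, 0))]
             | x <- interval (bound Q.1 (1, 0, 0))]).

Definition check_corner (Q : poly) (v : pt) : bool :=
  let c := corner Q v in
  [&& pt_eqb (apex c) v, check_dual c,
      allb (fun b => hasb (halfspace_eqb (b, dot b v)) Q.2) (nrms c)
    & allb (fun d => inside Q (padd v d)) (dirs c)].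

(* [dot e] is maximal at a vertex where it increases along no edge. *)
Definition check_bound (Q : poly) (e : pt) : bool :=
  hasb (halfspace_eqb (e, 0)) Q.2 &&
  hasb (fun v => Z.leb (dot e v) (bound Q.1 e)
                 && allb (fun d => Z.leb (dot e d) 0) (dirs (corner Q v))) Q.1.

(** [p = v + (t / n) (w - v)] with denominators cleared; orthogonal projection onto [w - v] yields
    the only possible parameter [t / n]. *)
Definition on_segment (p v w : pt) : bool :=
  let d := psub w v in let n := dot d d in let t := dot (psub p v) d in
  [&& Z.leb 0 t, Z.leb t n, Z.ltb 0 n & pt_eqb (pscale n (psub p v)) (pscale t d)].

(** That lattice points satisfying the inequalities lie in the hull of [Q.1] is tested in a stronger
    form, free of linear programming: each lies on a segment between two vertices. *)
Definition check_poly (Q : poly) : bool :=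
  [&& Nat.ltb 0 (size Q.1), uniq Q.1, allb (inside Q) Q.1, allb (check_corner Q) Q.1,
      allb (check_bound Q) basis,
      allb (fun p => hasb (fun v => hasb (on_segment p v) Q.1) Q.1) (lattice_points Q)
    & Nat.leb (size (lattice_points Q)) 12].

Lemma polys_checked : allb check_poly polys.
Proof. by vm_compute. Qed.

Definition sumz (f : pt -> Z) (s : seq pt) : Z := foldr (fun x a => f x + a) 0 s.

(** The even power removes the sign produced by maps that reverse orientation. *)
Definition simplex_sum (V : seq pt) : Z :=
  sumz (fun a => sumz (fun b => sumz (fun c => sumz (fun d =>
    let x := det (psub b a) (psub c a) (psub d a) in let y := x * x in y * y) V) V) V) V.

Lemma simplex_sum_uniq : uniq [seq simplex_sum Q.1 | Q <- polys].
Proof. by vm_compute. Qed.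

Lemma basis_ext (f g : pt -> pt) :
  (forall p q, f (padd p q) = padd (f p) (f q)) -> (forall k p, f (pscale k p) = pscale k (f p)) ->
  (forall p q, g (padd p q) = padd (g p) (g q)) -> (forall k p, g (pscale k p) = pscale k (g p)) ->
  (forall e, List.In e basis -> f e = g e) -> f =1 g.
Proof.
move=> fD fZ gD gZ fg [[x y] z].
have -> : (x, y, z) = padd (pscale x (1, 0, 0)) (padd (pscale y (0, 1, 0)) (pscale z (0, 0, 1))).
  by pt_ring.
rewrite !fD !gD !fZ !gZ; have [-> -> ->] :
  [/\ f (1, 0, 0) = g (1, 0, 0), f (0, 1, 0) = g (0, 1, 0) & f (0, 0, 1) = g (0, 0, 1)].
  by split; apply: fg; apply/In_mem.
by [].
Qed.

Lemma nrm_coordsD c p q : nrm_coords c (padd p q) = padd (nrm_coords c p) (nrm_coords c q).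
Proof. by rewrite /nrm_coords !dotDr. Qed.

Lemma check_dualP c : check_dual c -> dual_frame c.
Proof.
move=> /allbP ce; split.
  apply: (@basis_ext (fun p => nrm_coords c (comb c p)) id) => // [p q|k p|e /ce].
  - by rewrite combD nrm_coordsD.
  - by rewrite combZ nrm_coordsZ.
  - by case: ifP => // /pt_eqbP.
apply: (@basis_ext (fun p => comb c (nrm_coords c p)) id) => // [p q|k p|e /ce].
- by rewrite nrm_coordsD combD.
- by rewrite nrm_coordsZ combZ.
- by case: ifP => // _ /pt_eqbP.
Qed.

Lemma mem_interval x m : 0 <= x -> x <= m -> x \in interval m.
Proof. by move=> x0 xm; apply/mapP; exists (Z.to_nat x); rewrite ?mem_iota; lia. Qed.

Lemma insideP Q p : reflect (forall h, h \in Q.2 -> sat p h) (inside Q p).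
Proof. by apply: (iffP (allbP _ _)) => Qp h /In_mem /Qp. Qed.

Record smooth_poly (m : nat) (Q : poly) : Prop := SmoothPoly {
  poly_vertices : Q.1 != [::];
  poly_uniq : uniq Q.1;
  poly_inside : forall v, v \in Q.1 -> inside Q v;
  poly_corner : forall v, v \in Q.1 -> exists c, [/\ dual_frame c, apex c = v,
    forall p b, inside Q p -> b \in nrms c -> 0 <= dot b (psub p v)
    & forall d, d \in dirs c -> inside Q (padd v d)];
  poly_points : exists2 L, (size L <= m)%N & forall p, inside Q p -> p \in L;
  poly_hull : forall p, inside Q p -> exists v w,
    [/\ v \in Q.1, w \in Q.1 & on_segment p v w] }.

Lemma check_polyP Q : check_poly Q -> smooth_poly 12 Q.
Proof.
case/and5P => V0 V_uniq /allbP V_in /allbP V_corner /and3P[/allbP Q_bound /allbP Q_seg Q_size].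
have QV v : v \in Q.1 -> inside Q v by move=> /In_mem /V_in.
have corners v : v \in Q.1 -> let c := corner Q v in [/\ dual_frame c, apex c = v,
    forall p b, inside Q p -> b \in nrms c -> 0 <= dot b (psub p v)
    & forall d, d \in dirs c -> inside Q (padd v d)].
  move=> /In_mem /V_corner /and4P[/pt_eqbP cv /check_dualP fc /allbP cn /allbP cd]; split=> //.
    move=> p b /insideP Qp /In_mem /cn /hasbP [h /In_mem /Qp ph /halfspace_eqbP hE].
    by move: ph; rewrite -hE dotBr => /Z.leb_le /=; lia.
  by move=> d /In_mem /cd.
have in_box e p : e \in basis -> inside Q p -> 0 <= dot e p /\ dot e p <= bound Q.1 e.
  move=> /In_mem /Q_bound /andP[/hasbP [h /In_mem hQ /halfspace_eqbP eh]].
  move=> /hasbP [v /In_mem vQ /andP[/Z.leb_le ve /allbP ed]] Qp; split.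
    by have := insideP _ _ Qp h hQ; rewrite -eh => /Z.leb_le.
  have [fc cv cn _] := corners v vQ.
  apply: Z.le_trans ve; suff : dot e (psub p v) <= 0 by rewrite dotBr; lia.
  (* [p - v] has nonnegative coordinates along the edges at [v], and [e] is nonpositive on these. *)
  rewrite (dot_dual _ _ fc).
  have mulle b d : b \in nrms (corner Q v) -> List.In d (dirs (corner Q v)) ->
      dot b (psub p v) * dot e d <= 0.
    move=> /(cn p b Qp) b_ge0 /ed /Z.leb_le; nia.
  have := mulle (nrm1 (corner Q v)) (dir1 (corner Q v)).
  have := mulle (nrm2 (corner Q v)) (dir2 (corner Q v)).
  have := mulle (nrm3 (corner Q v)) (dir3 (corner Q v)).
  rewrite /nrms !inE !eqxx !orbT /= => h3 h2 h1.
  have {}h1 := h1 isT (or_introl erefl).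
  have {}h2 := h2 isT (or_intror (or_introl erefl)).
  have {}h3 := h3 isT (or_intror (or_intror (or_introl erefl))).
  by lia.
have in_points p : inside Q p -> p \in lattice_points Q.
  move=> Qp; rewrite mem_filter Qp andTb.
  have := (in_box (1, 0, 0) p isT Qp, in_box (0, 1, 0) p isT Qp, in_box (0, 0, 1) p isT Qp).
  case: p Qp => [[x y] z] Qp; rewrite /dot => -[[[x0 xm] [y0 ym]] [z0 zm]].
  apply/flatten_mapP; exists x; first by apply: mem_interval; lia.
  apply/flatten_mapP; exists y; first by apply: mem_interval; lia.
  by apply: map_f; apply: mem_interval; lia.
split=> //.
- by case: (Q.1) V0.
- by move=> v /corners; exists (corner Q v).
- by exists (lattice_points Q) => //; apply/ssrnat.leP/Nat.leb_le.
- move=> p /in_points /In_mem /Q_seg /hasbP [v /In_mem vQ /hasbP [w /In_mem wQ pvw]].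
  by exists v, w.
Qed.

Lemma det_comb c p q r : det (comb c p) (comb c q) (comb c r) =
  det (dir1 c) (dir2 c) (dir3 c) * det p q r.
Proof.
case: c => u d1 d2 d3 b1 b2 b3; rewrite /comb /=.
move: p q r d1 d2 d3 => [[? ?] ?] [[? ?] ?] [[? ?] ?] [[? ?] ?] [[? ?] ?] [[? ?] ?].
by cbv beta iota zeta delta [det cross psub padd pscale dot]; ring.
Qed.

(** This determinant divides that of the identity, so it is an integer unit. *)
Lemma det_dual c : dual_frame c -> det (dir1 c) (dir2 c) (dir3 c) = 1
  \/ det (dir1 c) (dir2 c) (dir3 c) = -1.
Proof.
case=> _ kc; have := det_comb c
  (nrm_coords c (1, 0, 0)) (nrm_coords c (0, 1, 0)) (nrm_coords c (0, 0, 1)).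
rewrite !kc => /esym /Z.mul_eq_1; case; [by left | by right].
Qed.

Lemma sumz_big f s : sumz f s = (\sum_(x <- s) f x)%R.
Proof. by elim: s => [|x s IHs]; rewrite ?big_nil ?big_cons //= IHs. Qed.

Lemma eq_sumz f g s : f =1 g -> sumz f s = sumz g s.
Proof. by move=> fg; rewrite !sumz_big; apply: eq_bigr => x _. Qed.

Lemma simplex_sum_map c V : dual_frame c -> simplex_sum (map (transport c) V) = simplex_sum V.
Proof.
move=> fc; have sumz_map f s : sumz f (map (transport c) s) = sumz (fun x => f (transport c x)) s.
  by rewrite /sumz foldr_map.
rewrite /simplex_sum !sumz_map; do 4!(rewrite ?sumz_map; apply: eq_sumz => ?).
by rewrite !transport_psub det_comb; case: (det_dual fc) => ->; ring.
Qed.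

Lemma simplex_sum_perm V W : perm_eq V W -> simplex_sum V = simplex_sum W.
Proof.
move=> VW; have sumz_perm f : sumz f V = sumz f W by rewrite !sumz_big; apply: perm_big.
by rewrite /simplex_sum sumz_perm; do 3!(apply: eq_sumz => ?; rewrite sumz_perm).
Qed.

Local Close Scope Z_scope.
Local Open Scope classical_set_scope.
Local Open Scope card_scope.
Local Open Scope ring_scope.

(** * Embedding in real space *)

Section Embedding.

Variable R : realType.

Definition zr (z : Z) : R := (int_of_Z z)%:~R.

Lemma zrD a b : zr (Z.add a b) = zr a + zr b.
Proof. by rewrite /zr (rmorphD int_of_Z a b) intrD. Qed.

Lemma zrM a b : zr (Z.mul a b) = zr a * zr b.
Proof. by rewrite /zr (rmorphM int_of_Z a b) intrM. Qed.

Lemma zrN a : zr (Z.opp a) = - zr a.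
Proof. by rewrite /zr (rmorphN int_of_Z a) mulrNz. Qed.

Lemma zr0 : zr Z0 = 0. Proof. by []. Qed.

Lemma zr1 : zr (Zpos xH) = 1. Proof. by []. Qed.

Lemma zr_le a b : (zr a <= zr b) = Z.leb a b.
Proof.
rewrite -subr_ge0 -zrN -zrD /zr ler0z.
apply/idP/idP => [|/Z.leb_le ab]; first move=> ab; first apply/Z.leb_le.
  by move: ab; case E : (Z.add _ _) => [|p|p] //=; lia.
by case E : (Z.add _ _) => [|p|p] //=; lia.
Qed.

Lemma zr_inj : injective zr.
Proof.
move=> a b ab; have := zr_le a b; have := zr_le b a; rewrite ab lexx.
by move=> /esym /Z.leb_le ? /esym /Z.leb_le ?; apply: Z.le_antisymm.
Qed.

Lemma zr_le0 a : (0 <= zr a) = Z.leb 0 a. Proof. by rewrite -zr_le. Qed.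

Definition coord (p : pt) (i : 'I_3) : Z := nth Z0 [:: p.1.1; p.1.2; p.2] i.

Definition iemb (p : pt) : 'rV[int]_3 := \row_i int_of_Z (coord p i).

Definition emb (p : pt) : 'rV[R]_3 := map_mx intr (iemb p).

Definition cemb (p : pt) : 'cV[R]_3 := map_mx intr (iemb p)^T.

Lemma embE p i : emb p 0 i = zr (coord p i).
Proof. by rewrite !mxE. Qed.

Lemma cembE p i : cemb p i 0 = zr (coord p i).
Proof. by rewrite !mxE. Qed.

Definition pt_of (w : 'rV[int]_3) : pt :=
  (Z_of_int (w 0 0), Z_of_int (w 0 1), Z_of_int (w 0 2%:R)).

Lemma pt_ofK : cancel pt_of iemb.
Proof.
move=> w; apply/rowP => i; rewrite !mxE.
case: i => [[|[|[|//]]] i_lt] /=; rewrite Z_of_intK; congr (w 0 _); exact: val_inj.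
Qed.

Lemma ord3P (P : 'I_3 -> Prop) : P 0 -> P 1 -> P 2%:R -> forall i, P i.
Proof.
move=> P0 P1 P2 [[|[|[|//]]] i_lt].
- by move: P0; congr P; apply: val_inj.
- by move: P1; congr P; apply: val_inj.
- by move: P2; congr P; apply: val_inj.
Qed.

Lemma eq_coord p q : coord p =1 coord q -> p = q.
Proof.
case: p q => [[x y] z] [[x' y'] z'] pq; move: (pq 0) (pq 1) (pq 2%:R).
by rewrite /coord /= => -> -> ->.
Qed.

Lemma emb_inj : injective emb.
Proof.
move=> p q /rowP pq; apply: eq_coord => i; apply: zr_inj.
by rewrite -!embE.
Qed.

Lemma latticeP (x : 'rV[R]_3) : lattice R 3 x <-> exists p, x = emb p.
Proof.
split=> [[w _ <-]|[p ->]]; last by exists (iemb p).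
by exists (pt_of w); rewrite /emb pt_ofK.
Qed.

Lemma coord_padd p q i : coord (padd p q) i = Z.add (coord p i) (coord q i).
Proof.
by case: p q => [[? ?] ?] [[? ?] ?]; case: i => [[|[|[|//]]] ?].
Qed.

Lemma coord_pscale k p i : coord (pscale k p) i = Z.mul k (coord p i).
Proof. by case: p => [[? ?] ?]; case: i => [[|[|[|//]]] ?]. Qed.

Lemma embD p q : emb (padd p q) = emb p + emb q.
Proof. by apply/rowP => i; rewrite [RHS]mxE !embE coord_padd zrD. Qed.

Lemma embZ k p : emb (pscale k p) = zr k *: emb p.
Proof. by apply/rowP => i; rewrite [RHS]mxE !embE coord_pscale zrM. Qed.

Lemma embB p q : emb (psub p q) = emb p - emb q.
Proof. by rewrite embD embZ (zrN (Zpos xH)) zr1 scaleN1r. Qed.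

Lemma cembT p : cemb p = (emb p)^T.
Proof. by rewrite /cemb map_trmx. Qed.

Lemma pairingDl (u u' : 'rV[R]_3) v : pairing (u + u') v = pairing u v + pairing u' v.
Proof. by rewrite /pairing mulmxDl mxE. Qed.

Lemma pairingZl a (u : 'rV[R]_3) v : pairing (a *: u) v = a * pairing u v.
Proof. by rewrite /pairing -scalemxAl mxE. Qed.

Lemma pairingBl (u u' : 'rV[R]_3) v : pairing (u - u') v = pairing u v - pairing u' v.
Proof. by rewrite pairingDl -scaleN1r pairingZl mulN1r. Qed.

Lemma pairing0l (v : 'cV[R]_3) : pairing 0 v = 0.
Proof. by rewrite /pairing mul0mx mxE. Qed.

Lemma pairingDr (u : 'rV[R]_3) v v' : pairing u (v + v') = pairing u v + pairing u v'.
Proof. by rewrite /pairing mulmxDr mxE. Qed.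

Lemma pairingZr a (u : 'rV[R]_3) v : pairing u (a *: v) = a * pairing u v.
Proof. by rewrite /pairing -scalemxAr mxE. Qed.

Lemma pairingBr (u : 'rV[R]_3) v v' : pairing u (v - v') = pairing u v - pairing u v'.
Proof. by rewrite pairingDr -scaleN1r pairingZr mulN1r. Qed.

Lemma pairingNr (u : 'rV[R]_3) v : pairing u (- v) = - pairing u v.
Proof. by rewrite -scaleN1r pairingZr mulN1r. Qed.

Lemma pairing3 (u : 'rV[R]_3) v :
  pairing u v = u 0 0 * v 0 0 + u 0 1 * v 1 0 + u 0 2%:R * v 2%:R 0.
Proof.
rewrite /pairing mxE !big_ord_recr big_ord0 /= add0r.
by congr (u 0 _ * v _ 0 + u 0 _ * v _ 0 + u 0 _ * v _ 0); apply: val_inj.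
Qed.

Lemma pairing_emb p b : pairing (emb p) (cemb b) = zr (dot b p).
Proof.
rewrite pairing3 !embE !cembE; case: p b => [[x y] z] [[x' y'] z'].
by rewrite /coord /= !zrD !zrM ![zr x' * _]mulrC ![zr y' * _]mulrC ![zr z' * _]mulrC.
Qed.

(** The identity as a sum of rank-one matrices: multiplying it by a row on the left gives
    [row_frame], by a column on the right [col_frame]. *)
Lemma sum_nrm_dir c : dual_frame c ->
  cemb (nrm1 c) *m emb (dir1 c) + cemb (nrm2 c) *m emb (dir2 c)
  + cemb (nrm3 c) *m emb (dir3 c) = 1%:M.
Proof.
case=> _ kc; apply/matrixP => i j.
rewrite !mxE !big_ord_recl !big_ord0 !addr0 !cembE !embE -!zrM -!zrD.
pose e (i : 'I_3) : pt := nth (0, 0, 0)%coqZ [:: (1, 0, 0); (0, 1, 0); (0, 0, 1)]%coqZ i.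
have dote b k : dot b (e k) = coord b k.
  case: b => [[x y] z]; move: k; apply: ord3P; rewrite /e /coord /dot /=; lia.
have := congr1 (coord ^~ j) (kc (e i)).
rewrite /nrm_coords !dote /comb !coord_padd !coord_pscale Z.add_assoc => ->.
by move: i j; do 2 apply: ord3P.
Qed.

Lemma row_frame c (x : 'rV[R]_3) : dual_frame c ->
  x = pairing x (cemb (nrm1 c)) *: emb (dir1 c) + pairing x (cemb (nrm2 c)) *: emb (dir2 c)
      + pairing x (cemb (nrm3 c)) *: emb (dir3 c).
Proof.
move=> fc; have pE (b : 'cV[R]_3) (d : 'rV[R]_3) : pairing x b *: d = x *m (b *m d).
  by rewrite mulmxA [x *m b]mx11_scalar mul_scalar_mx.
by rewrite !pE -!mulmxDr sum_nrm_dir // mulmx1.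
Qed.

Lemma col_frame c (v : 'cV[R]_3) : dual_frame c ->
  v = pairing (emb (dir1 c)) v *: cemb (nrm1 c) + pairing (emb (dir2 c)) v *: cemb (nrm2 c)
      + pairing (emb (dir3 c)) v *: cemb (nrm3 c).
Proof.
move=> fc; have pE (b : 'cV[R]_3) (d : 'rV[R]_3) : pairing d v *: b = (b *m d) *m v.
  by rewrite -mulmxA [d *m v]mx11_scalar mul_mx_scalar.
by rewrite !pE -!mulmxDl sum_nrm_dir // mul1mx.
Qed.

Lemma convex_setP (A : set 'rV[R]_3) : @convex_set R 'rV[R]_3 A <->
  forall x y (t : R), 0 <= t -> t <= 1 -> A x -> A y -> A (t *: x + (1 - t) *: y).
Proof.
split=> [cA x y t t0 t1 Ax Ay|cA x y t /set_mem Ax /set_mem Ay].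
  exact: (set_mem (cA x y (Itv01 t0 t1) (mem_set Ax) (mem_set Ay))).
by apply/mem_set; apply: cA.
Qed.

Lemma hull_convex (A : set 'rV[R]_3) x y (t : R) : 0 <= t -> t <= 1 ->
  convex_hull A x -> convex_hull A y -> convex_hull A (t *: x + (1 - t) *: y).
Proof.
move=> t0 t1 Ax Ay B BA; have [/convex_setP cB _] := BA.
by apply: cB => //; [exact: Ax | exact: Ay].
Qed.

Lemma sub_hull (A : set 'rV[R]_3) : A `<=` convex_hull A.
Proof. exact: sub_gen_smallest. Qed.

Lemma hull_sub (A B : set 'rV[R]_3) :
  (forall x y (t : R), 0 <= t -> t <= 1 -> B x -> B y -> B (t *: x + (1 - t) *: y)) ->
  A `<=` B -> convex_hull A `<=` B.
Proof. by move=> /convex_setP cB AB; apply: smallest_sub. Qed.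

Lemma hull_halfspace (A : set 'rV[R]_3) (b : 'cV[R]_3) (m : R) :
  (forall x, A x -> m <= pairing x b) ->
  forall x, convex_hull A x -> m <= pairing x b.
Proof.
move=> Ab; apply: hull_sub Ab => x y t t0 t1 mx my.
rewrite pairingDl !pairingZl -[m](_ : t * m + (1 - t) * m = m); last first.
  by rewrite -mulrDl addrC subrK mul1r.
by apply: lerD; apply: ler_wpM2l; rewrite ?subr_ge0.
Qed.

End Embedding.

Lemma card_set_seq (T : choiceType) (s : seq T) : uniq s -> [set` s] #= `I_(size s).
Proof.
move=> us; case: s us => [_|x s us]; first by rewrite set_nil II0 card_eq00.
rewrite (_ : [set` x :: s] = nth x (x :: s) @` `I_(size (x :: s))).
  by apply: inj_card_eq => i j /set_mem /= i_lt /set_mem /= j_lt /eqP; rewrite nth_uniq // => /eqP.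
apply/seteqP; split=> [y /= /(nthP x) [i i_lt <-]|_ [i i_lt <-]]; first by exists i.
exact: mem_nth.
Qed.

(** * Integer matrices, lattice bases and primitive vectors *)

Lemma int_dot b p : int_of_Z (dot b p) = (iemb p *m (iemb b)^T) 0 0.
Proof.
rewrite !mxE !big_ord_recl big_ord0 addr0 !mxE.
case: p b => [[x y] z] [[x' y'] z']; rewrite /coord /=.
rewrite (rmorphD int_of_Z) (rmorphD int_of_Z) !(rmorphM int_of_Z) -addrA.
by congr (_ + (_ + _)); apply: mulrC.
Qed.

Lemma iembD p q : iemb (padd p q) = iemb p + iemb q.
Proof. by apply/rowP => i; rewrite !mxE coord_padd; exact: (rmorphD int_of_Z). Qed.

Lemma iembZ k p : iemb (pscale k p) = int_of_Z k *: iemb p.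
Proof. by apply/rowP => i; rewrite !mxE coord_pscale; exact: (rmorphM int_of_Z). Qed.

Lemma iemb_inj : injective iemb.
Proof.
move=> p q /rowP pq; apply: eq_coord => i; move: (pq i); rewrite !mxE.
exact: (can_inj int_of_ZK).
Qed.

Lemma frame_of_mx (nr dr : 'M[int]_3) u : nr *m dr = 1%:M ->
  exists c, [/\ dual_frame c, apex c = u,
    [/\ iemb (dir1 c) = row 0 dr, iemb (dir2 c) = row 1 dr & iemb (dir3 c) = row 2%:R dr]
    & [/\ (iemb (nrm1 c))^T = col 0 nr, (iemb (nrm2 c))^T = col 1 nr
        & (iemb (nrm3 c))^T = col 2%:R nr]].
Proof.
move=> nd; have dn := mulmx1C nd.
pose n_ i := pt_of (col i nr)^T; pose d_ i := pt_of (row i dr).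
pose c := Frame u (d_ 0) (d_ 1) (d_ 2%:R) (n_ 0) (n_ 1) (n_ 2%:R).
have nE i : (iemb (n_ i))^T = col i nr by rewrite pt_ofK trmxK.
have iN p : iemb (nrm_coords c p) = iemb p *m nr.
  have dotM i : int_of_Z (dot (n_ i) p) = (iemb p *m nr) 0 i.
    by rewrite int_dot nE !mxE; apply: eq_bigr => k _; rewrite !mxE.
  by apply/rowP; apply: ord3P; rewrite mxE -dotM.
have iC p : iemb (comb c p) = iemb p *m dr.
  case: p => [[x y] z]; rewrite /comb !iembD !iembZ !pt_ofK.
  apply/rowP => j; rewrite !mxE !big_ord_recl big_ord0 addr0 !mxE.
  by congr (_ * dr _ j + (_ * dr _ j + _ * dr _ j)); apply: val_inj.
exists c; split=> //; [|by split; rewrite pt_ofK|by split; apply: nE].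
split=> p; apply: iemb_inj.
  by rewrite iN iC -mulmxA dn mulmx1.
by rewrite iC iN -mulmxA nd mulmx1.
Qed.

(** Expanding the unit vectors in the basis gives an integer inverse matrix, whose rows are the
    directions. *)
Lemma lattice_basis_frame (b : 'I_3 -> 'cV[int]_3) u : lattice_basis b ->
  exists c, [/\ dual_frame c, apex c = u
    & [/\ (iemb (nrm1 c))^T = b 0, (iemb (nrm2 c))^T = b 1 & (iemb (nrm3 c))^T = b 2%:R]].
Proof.
move=> bb; pose nr := \matrix_(k, i) b i k 0 : 'M[int]_3.
have /fin_all_exists [f fE] (j : 'I_3) :
    exists c : {ffun 'I_3 -> int}, delta_mx j 0 = \sum_i c i *: b i.
  by case: (bb (delta_mx j 0)) => c [cE _]; exists c.
have nd : nr *m \matrix_(i, j) f j i = 1%:M.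
  apply/matrixP => k j; rewrite !mxE; have /matrixP/(_ k 0) := fE j.
  rewrite mxE eqxx andbT summxE => ->; apply: eq_bigr => i _.
  by rewrite !mxE mulrC.
have [c [fc cu _ cn]] := frame_of_mx u nd.
have colE i : col i nr = b i by apply/colP => k; rewrite !mxE.
by exists c; split=> //; move: cn; rewrite !colE.
Qed.

(** [g] is the largest positive divisor of [v], bounded by a nonzero coordinate. A factor [k] of the
    quotient would make [g |k|] a divisor too, so [|k| = 1]. *)
Lemma exists_primitive (v : pt) : v <> (0, 0, 0)%coqZ -> exists g w,
  [/\ (0 < g)%coqZ, v = pscale g w & primitive (iemb w)^T].
Proof.
move=> v_neq0; have [i vi0] : exists i, coord v i <> Z0.
  apply: contrapT => /forallNP v0; apply: v_neq0; apply: eq_coord => i.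
  by have /contrapT -> := v0 i; move: i; apply: ord3P.
pose mult g := `[< (0 < g)%N /\ exists w, v = pscale (Z.of_nat g) w >].
have mult1 : exists g, mult g.
  by exists 1%N; apply/asboolP; split=> //; exists v; rewrite pscale1.
have bound g : mult g -> (g <= Z.to_nat (Z.abs (coord v i)))%N.
  move=> /asboolP [g_gt0 [w vE]]; rewrite vE coord_pscale in vi0 *.
  move: (coord w i) vi0 => x; clear => gx; apply/ssrnat.leP.
  have x1 : (1 <= Z.abs x)%coqZ.
    have : x <> Z0 by move=> x0; apply: gx; rewrite x0 Z.mul_0_r.
    by clear; lia.
  have : (Z.of_nat g <= Z.abs (Z.of_nat g * x))%coqZ by rewrite Z.abs_mul; nia.
  by clear; lia.
have [g /asboolP [g_gt0 [w vE]] gmax] := ex_maxnP mult1 bound.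
exists (Z.of_nat g), w; split=> //; first by lia.
move=> k w' wE; have [k' kE] : exists k', k = int_of_Z k' by exists (Z_of_int k); rewrite Z_of_intK.
have wE' : w = pscale k' (pt_of w'^T).
  apply: eq_coord => j; rewrite coord_pscale; apply: (can_inj int_of_ZK).
  rewrite (rmorphM int_of_Z); have /colP/(_ j) := wE; rewrite !mxE kE => ->.
  by congr (_ * _); rewrite -[w' in LHS]trmxK -[w'^T in LHS]pt_ofK !mxE.
pose s := Z.sgn k'; have le_g : (g * Z.to_nat (Z.abs k') <= g)%N.
  apply: gmax; apply/asboolP; split.
    rewrite muln_gt0 g_gt0; apply/ssrnat.leP; suff : k' <> Z0 by clear; lia.
    by move=> k0; apply: vi0; rewrite vE wE' k0 !coord_pscale Z.mul_0_r.
  exists (pscale s (pt_of w'^T)); rewrite vE {1}wE'; apply: eq_coord => j.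
  rewrite !coord_pscale /s; move: (coord _ _) => x; clear.
  by rewrite Nat2Z.inj_mul Z2Nat.id; [rewrite -{1}(Z.abs_sgn k'); ring | lia].
rewrite kE; have : Z.abs k' = Zpos xH.
  have : k' <> Z0 by move=> k0; apply: vi0; rewrite vE wE' k0 !coord_pscale Z.mul_0_r.
  move: le_g g_gt0; rewrite -[X in (_ <= X)%N]muln1; clear.
  by case: g => // g; rewrite leq_pmul2l // => /ssrnat.leP; lia.
by case: (k') => [|[p|p|]|[p|p|]].
Qed.

(** * From polytopes to sets of lattice points *)

Section Bridge.

Variable R : realType.
Implicit Types (P : set 'rV[R]_3) (S : seq pt).

Definition lattice_hull P S : Prop :=
  (forall p, p \in S <-> P (emb R p)) /\ P = convex_hull (@emb R @` [set` S]).

Lemma lattice_hull_exists P m : lattice_polytope P -> P `&` lattice R 3 #<= `I_m ->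
  exists2 S, (size S <= m)%N & lattice_hull P S.
Proof.
move=> [V [_ V_lattice PV]] P_m; pose A := [set p | P (emb R p)].
have A_m : A #<= `I_m.
  apply: card_le_trans P_m; rewrite (_ : P `&` _ = @emb R @` A).
    have := inj_card_eq (f := @emb R) (A := A) (in2W (@emb_inj R)).
    by rewrite card_eq_le => /andP[].
  apply/seteqP; split=> [x [Px /latticeP [p xE]]|_ [p Ap <-]].
    by exists p; rewrite // /A /= -xE.
  by split=> //; apply/latticeP; exists p.
have /finite_seqP [s AE] : finite_set A by apply: sub_finite_set (card_le_finite A_m _).
exists (undup s).
  rewrite -card_le_II; have := card_set_seq (undup_uniq s); rewrite card_eq_le => /andP[_ h].
  apply: card_le_trans h _; rewrite (_ : [set` undup s] = A) // AE.
  by apply/seteqP; split=> p /=; rewrite mem_undup.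
have sA p : p \in undup s <-> P (emb R p).
  by rewrite mem_undup; have : [set` s] p <-> A p by rewrite AE.
split=> //; rewrite PV; apply/seteqP; split; apply: hull_sub; try exact: hull_convex.
  move=> x Vx; have /latticeP [p xE] := V_lattice _ Vx; rewrite xE; apply: sub_hull.
  by exists p => //=; apply/sA; rewrite PV -xE; apply: sub_hull.
by move=> _ [p /= /sA Pp <-]; rewrite -PV.
Qed.

(** A functional constant on [S] is constant on the hull, so it kills the rows of the invertible
    matrix that witnesses full dimension. *)
Lemma full_dimensional_span P S u (v : 'cV[R]_3) : lattice_hull P S -> full_dimensional P ->
  (forall p, p \in S -> pairing (emb R p - u) v = 0) -> v = 0.
Proof.
move=> [SP PE] [u0 [B [Pu0 PB Bfree]]] Sv.
have Pv x : P x -> pairing (x - u) v = 0.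
  have Sv' p : p \in S -> pairing (emb R p) v = pairing u v.
    by move=> /Sv /eqP; rewrite pairingBl subr_eq0 => /eqP.
  rewrite PE pairingBl => Px; apply/eqP; rewrite subr_eq0 eq_le; apply/andP; split.
    rewrite -lerN2 -!pairingNr; apply: (hull_halfspace (A := @emb R @` [set` S])) Px => _ [p pS <-].
    by rewrite !pairingNr Sv'.
  by apply: (hull_halfspace (A := @emb R @` [set` S])) Px => _ [p pS <-]; rewrite Sv'.
have Bv : B *m v = 0.
  apply/row_matrixP => i; rewrite row_mul row0; apply/matrixP => j k; rewrite !ord1 [RHS]mxE.
  rewrite -/(pairing _ _) (_ : row i B = (u0 + row i B - u) - (u0 - u)); last first.
    by rewrite opprB addrA subrK addrAC subrr add0r.
  by rewrite pairingBl !Pv // subrr.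
by move: Bfree; rewrite row_free_unit => Bu; rewrite -[v](mulKmx Bu) Bv mulmx0.
Qed.

Lemma strict_min_vertex P S u f : lattice_hull P S -> u \in S ->
  (forall p, p \in S -> p <> u -> (0 < dot f (psub p u))%coqZ) -> vertices P (emb R u).
Proof.
move=> [SP PE] uS fu; split; first by apply/SP.
exists (cemb R f) => x; rewrite PE => Px xu.
(* Being [u] or strictly above [u] is a convex property, so it passes from [S] to the hull. *)
suff : x = emb R u \/ 0 < pairing (x - emb R u) (cemb R f) by case.
apply: (hull_sub (B := [set x | x = emb R u \/ 0 < pairing (x - emb R u) (cemb R f)])) Px
  => [y z t t0 t1|_ [p pS <-]] /=; last first.
  have [->|/eqP pu] := eqVneq p u; [by left | right].
  rewrite -embB pairing_emb ltNge -(zr0 R) zr_le.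
  by apply/negP => /Z.leb_le; have := fu p pS pu; lia.
have [->|] := eqVneq t 0; first by rewrite scale0r add0r subr0 scale1r.
have [->|t_neq1 t_neq0] := eqVneq t 1; first by rewrite subrr scale0r addr0 scale1r.
have {t_neq0} t_gt0 : 0 < t by rewrite lt_neqAle eq_sym t_neq0.
have {t_neq1} t_lt1 : 0 < 1 - t by rewrite subr_gt0 lt_neqAle t_neq1.
move=> yP zP.
have -> : t *: y + (1 - t) *: z - emb R u = t *: (y - emb R u) + (1 - t) *: (z - emb R u).
  rewrite !scalerBr addrACA -opprD -scalerDl [t + _]addrC subrK scale1r //.
rewrite pairingDl !pairingZl; case: yP zP => [->|y_gt0] [->|z_gt0].
- by left; rewrite -scalerDl [t + _]addrC subrK scale1r.
- by right; rewrite subrr pairing0l mulr0 add0r mulr_gt0.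
- by right; rewrite subrr pairing0l mulr0 addr0 mulr_gt0.
- by right; rewrite addr_gt0 // mulr_gt0.
Qed.

Lemma zr_of_nat n : zr R (Z.of_nat n) = n%:R.
Proof. by elim: n => // n IHn; rewrite Nat2Z.inj_succ -Z.add_1_r zrD IHn -natr1. Qed.

Lemma lattice_hull_convex P S p d (n t : nat) : lattice_hull P S ->
  p \in S -> padd p (pscale (Z.of_nat n) d) \in S -> (t <= n)%N ->
  padd p (pscale (Z.of_nat t) d) \in S.
Proof.
move=> [SP PE] pS qS tn; have [n0|n_gt0] := posnP n.
  by move: tn qS; rewrite n0 leqn0 => /eqP ->.
have n_neq0 : n%:R != 0 :> R by rewrite pnatr_eq0 -lt0n.
apply/SP; rewrite (_ : emb R _ = (t%:R / n%:R) *: emb R (padd p (pscale (Z.of_nat n) d))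
  + (1 - t%:R / n%:R) *: emb R p).
  rewrite PE; apply: hull_convex; rewrite -?PE; try exact/SP.
    by rewrite divr_ge0 ?ler0n.
  by rewrite ler_pdivrMr ?ltr0n // mul1r ler_nat.
rewrite !embD !embZ !zr_of_nat scalerDr scalerA divfK // addrAC -scalerDl.
by rewrite [t%:R / _ + _]addrC subrK scale1r.
Qed.

Lemma normal_cone_cemb P S u b : lattice_hull P S ->
  (forall p, p \in S -> (0 <= dot b (psub p u))%coqZ) -> normal_cone P (emb R u) (cemb R b).
Proof.
move=> [_ ->] Sb x Px; rewrite pairingBl subr_ge0.
apply: (hull_halfspace (A := @emb R @` [set` S])) Px => _ [p pS <-].
by rewrite -subr_ge0 -pairingBl -embB pairing_emb zr_le0; apply/Z.leb_le/Sb.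
Qed.

(** If [v = x + y] in the cone, [x] vanishes wherever [v] is tight. Choose [r] so that [x - r v]
    vanishes on [dir1 c]; it also vanishes at [q] and [q'], which are independent modulo [dir1 c],
    so it is 0. A negative [r] would make [v] vanish on all of [S]. *)
Lemma extreme_ray P S c v q q' : lattice_hull P S -> full_dimensional P -> dual_frame c ->
  (forall p, p \in S -> (0 <= dot v (psub p (apex c)))%coqZ) ->
  (dot v (dir1 c) < 0)%coqZ -> q \in S -> q' \in S ->
  dot v (psub q (apex c)) = Z0 -> dot v (psub q' (apex c)) = Z0 ->
  (coords c q).1.2 * (coords c q').2 <> (coords c q).2 * (coords c q').1.2 ->
  spans_extreme_ray (normal_cone P (emb R (apex c))) (cemb R v).
Proof.
move=> hPS P_dim fc v_ge0 v1_lt0 qS q'S vq vq' qq'.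
have sv := normal_cone_cemb hPS v_ge0; have [SP _] := hPS.
have v1 : pairing (emb R (dir1 c)) (cemb R v) < 0.
  by rewrite pairing_emb ltNge zr_le0; apply/negP => /Z.leb_le; lia.
split=> //; first by apply: contraTneq v1 => ->;
  rewrite -(scale0r (0 : 'cV[R]_3)) pairingZr mul0r ltxx.
move=> x y sx sy xy; set u := apex c in sx sy sv.
have tight p : p \in S -> dot v (psub p u) = Z0 -> pairing (emb R (psub p u)) x = 0.
  move=> pS /(congr1 (zr R)); rewrite -pairing_emb -xy pairingDr embB => /eqP.
  by rewrite paddr_eq0 ?sx ?sy //; [case/andP => /eqP -> | apply/SP | apply/SP].
pose r := pairing (emb R (dir1 c)) x / pairing (emb R (dir1 c)) (cemb R v).
pose w := x - r *: cemb R v.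
have w1 : pairing (emb R (dir1 c)) w = 0.
  by rewrite pairingBr pairingZr divfK ?subrr // lt_eqF.
pose w2 := pairing (emb R (dir2 c)) w; pose w3 := pairing (emb R (dir3 c)) w.
have tw p : p \in S -> dot v (psub p u) = Z0 ->
    zr R (coords c p).1.2 * w2 + zr R (coords c p).2 * w3 = 0.
  move=> pS vp; have : pairing (emb R (psub p u)) w = 0.
    by rewrite pairingBr pairingZr tight // pairing_emb vp mulr0 subrr.
  by rewrite {1}(row_frame (emb R (psub p u)) fc) !pairingDl !pairingZl w1 mulr0 add0r !pairing_emb.
have [] := (tw q qS vq, tw q' q'S vq').
move: (coords c q) (coords c q') qq' => [[? a2] a3] [[? b2] b3] /= ab ea eb.
have {ab} ab : zr R a2 * zr R b3 - zr R a3 * zr R b2 != 0.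
  by rewrite -!zrM -zrN -zrD -(zr0 R); apply/eqP => /zr_inj; lia.
have w2_0 : w2 = 0.
  apply: (mulfI ab); rewrite mulr0 mulrBl -[_ * w2]mulrA [zr R b3 * w2]mulrC mulrA.
  transitivity (zr R b3 * (zr R a2 * w2 + zr R a3 * w3) - zr R a3 * (zr R b2 * w2 + zr R b3 * w3)).
    by ring.
  by rewrite ea eb !mulr0 subrr.
have w3_0 : w3 = 0.
  apply: (mulfI ab); rewrite mulr0.
  transitivity (zr R a2 * (zr R b2 * w2 + zr R b3 * w3) - zr R b2 * (zr R a2 * w2 + zr R a3 * w3)).
    by ring.
  by rewrite ea eb !mulr0 subrr.
have w0 : w = 0 by rewrite (col_frame w fc) w1 -/w2 -/w3 w2_0 w3_0 !scale0r !addr0.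
have xE : x = r *: cemb R v by apply/eqP; rewrite -subr_eq0 -/w w0.
exists r => //; rewrite leNgt; apply/negP => r_lt0.
have v0 : cemb R v = 0.
  apply: (full_dimensional_span (u := emb R u) hPS P_dim) => p pS; apply/eqP.
  have Pp := (SP p).1 pS; rewrite eq_le sv // andbT.
  by have := sx _ Pp; rewrite xE pairingZr nmulr_rge0.
by move: v1; rewrite v0 -(scale0r (0 : 'cV[R]_3)) pairingZr mul0r ltxx.
Qed.

(** Any point of [S] on the open ray along [dir1 c] yields the first lattice point by convexity.
    Without one, [missing_edge] and [extreme_ray] produce a primitive extreme ray negative on
    [dir1 c], against the last hypothesis. *)
Lemma edge_point P S c : lattice_hull P S -> full_dimensional P -> dual_frame c ->
  apex c \in S ->
  (forall p, p \in S -> (0 <= dot (nrm1 c) (psub p (apex c)))%coqZ) ->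
  (forall p, p \in S -> (0 <= dot (nrm2 c) (psub p (apex c)))%coqZ) ->
  (forall p, p \in S -> (0 <= dot (nrm3 c) (psub p (apex c)))%coqZ) ->
  (forall v, primitive (iemb v)^T ->
     spans_extreme_ray (normal_cone P (emb R (apex c))) (cemb R v) ->
     (0 <= dot v (dir1 c))%coqZ) ->
  padd (apex c) (dir1 c) \in S.
Proof.
move=> hPS P_dim fc uS n1 n2 n3 rays; have [ck kc] := fc.
have [/hasP[k kS /andP[/Z.ltb_lt k_gt0 /eqP kE]]|no_edge] :=
  boolP (has (fun p => (Z.ltb 0 (coords c p).1.1) && (coords c p == ((coords c p).1.1, Z0, Z0))) S).
  have := @lattice_hull_convex P S (apex c) (dir1 c) (Z.to_nat (coords c k).1.1) 1 hPS uS.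
  rewrite pscale1; apply; last by lia.
  rewrite Z2Nat.id; last by lia.
  rewrite (_ : padd _ _ = k) //; rewrite -{2}(coordsK fc k) kE /transport /comb.
  move: (coords c k).1.1 => x; congr padd; rewrite -[(x, _, _).1.1]/x.
  by move: (dir1 c) (dir2 c) (dir3 c) => [[? ?] ?] [[? ?] ?] [[? ?] ?]; pt_ring.
exfalso; have := @missing_edge (map (coords c) S).
case.
- by move=> _ /mapP[p pS ->]; split; [apply: n1 | apply: n2 | apply: n3].
- move=> k k_gt0; apply/mapP => -[p pS kE]; move/hasPn: no_edge => /(_ p pS).
  by rewrite -kE /= eqxx andbT => /negP; apply; apply/Z.ltb_lt.
- move=> w wS; have pw0 : cemb R (pull c w) = 0.
    apply: (full_dimensional_span (u := emb R (apex c)) hPS P_dim) => p pS.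
    by rewrite -embB pairing_emb dot_pull wS //; exact: (map_f (coords c)).
  have dw q : dot w q = Z0.
    rewrite -(ck q) -dot_pull; apply: (zr_inj (R := R)); rewrite -pairing_emb pw0.
    by rewrite -(scale0r (0 : 'cV[R]_3)) pairingZr mul0r.
  have := (dw (1, 0, 0)%coqZ, dw (0, 1, 0)%coqZ, dw (0, 0, 1)%coqZ).
  case: (w) => [[x y] z] [[]]; rewrite /dot => ? ? ?; apply: pt_eq; lia.
move=> v [t [t' [v1 v_ge0 [/mapP[q qS tE] /mapP[q' q'S t'E]] [vt vt'] tt']]].
have [|g [w [g_gt0 vE w_prim]]] := @exists_primitive (pull c v).
  move=> v0; have := dot_pull c v (dir1 c); have [-> _ _] := dual_frame_dot fc.
  by rewrite v0; move: v1; case: (v) (dir1 c) => [[x y] z] [[? ?] ?]; rewrite /dot /=; lia.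
have wE p : Z.mul g (dot w (psub p (apex c))) = dot v (coords c p).
  by rewrite -dotZl -vE dot_pull.
have w1E : Z.mul g (dot w (dir1 c)) = v.1.1.
  rewrite -dotZl -vE dot_pull; have [-> _ _] := dual_frame_dot fc.
  by case: (v) => [[x y] z]; rewrite /dot /=; lia.
have w1 : (dot w (dir1 c) < 0)%coqZ by nia.
suff : (0 <= dot w (dir1 c))%coqZ by lia.
apply: rays => //; apply: (extreme_ray hPS P_dim fc _ w1 qS q'S).
- move=> p pS; have := v_ge0 (coords c p) (map_f _ pS); rewrite -wE; nia.
- by have := wE q; rewrite -tE vt; nia.
- by have := wE q'; rewrite -t'E vt'; nia.
- by rewrite -tE -t'E.
Qed.

End Bridge.

Section SmoothPolytope.

Variable R : realType.
Implicit Types (P : set 'rV[R]_3) (S : seq pt).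

Lemma cone_of_unimodular P S u : lattice_hull P S -> full_dimensional P -> u \in S ->
  unimodular (normal_cone P (emb R u)) -> exists2 c, apex c = u & cone_at S c.
Proof.
move=> hPS P_dim uS [b bb bE]; have [c [fc cu [b0 b1 b2]]] := lattice_basis_frame u bb.
have [SP _] := hPS.
have nn v i : (iemb v)^T = b i -> forall p, p \in S -> (0 <= dot v (psub p (apex c)))%coqZ.
  move=> vb p pS; have : range b (b i) by exists i.
  rewrite -bE => -[_ [sb _ _]]; have := sb _ ((SP p).1 pS).
  by rewrite -vb -embB pairing_emb zr_le0 cu => /Z.leb_le.
have rays v : primitive (iemb v)^T ->
    spans_extreme_ray (normal_cone P (emb R (apex c))) (cemb R v) ->
    [\/ v = nrm1 c, v = nrm2 c | v = nrm3 c].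
  rewrite cu => v_prim v_ray; have : range b (iemb v)^T by rewrite -bE; split.
  case=> i _; move: i; apply: ord3P; rewrite -?b0 -?b1 -?b2 => /trmx_inj /iemb_inj ->.
  - exact: Or31.
  - exact: Or32.
  - exact: Or33.
have [[e11 e12 e13] [e21 e22 e23] [e31 e32 e33]] := dual_frame_dot fc.
have uS' : apex c \in S by rewrite cu.
have [n1 [n2 n3]] := (nn _ _ b0, (nn _ _ b1, nn _ _ b2)).
exists c => //; split=> //.
- apply: (edge_point hPS P_dim fc) => //.
  by move=> v v_prim /(rays _ v_prim)[] ->; rewrite ?e11 ?e12 ?e13.
- apply: (@edge_point R P S (rot c)) => //; first exact: dual_frame_rot.
  by move=> v v_prim /(rays _ v_prim)[] ->; rewrite ?e21 ?e22 ?e23.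
- apply: (@edge_point R P S (rot (rot c))) => //.
    by do 2 apply: dual_frame_rot.
  by move=> v v_prim /(rays _ v_prim)[] ->; rewrite ?e31 ?e32 ?e33.
Qed.

Lemma smooth_polytope_points P m : smooth_polytope P -> P `&` lattice R 3 #<= `I_m ->
  exists S, [/\ lattice_hull P S, smooth_points m S & S != [::]].
Proof.
move=> [P_lattice P_dim P_smooth] P_m.
have [S Sm hPS] := lattice_hull_exists P_lattice P_m; exists S; split=> //.
  split=> // [p d n t pS qS tn|u f uS fu]; first exact: (lattice_hull_convex hPS pS qS tn).
  exact: (cone_of_unimodular hPS P_dim uS (P_smooth _ (strict_min_vertex hPS uS fu))).
apply/eqP => S0; case: P_dim => u [B [Pu _ _]]; have [_ PE] := hPS.
have hull0 : convex_hull (@emb R @` [set` [::]]) `<=` set0.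
  by apply: hull_sub => // _ [p /= pn _]; rewrite in_nil in pn.
by move: Pu; rewrite PE S0 => /hull0.
Qed.

(** * Integral equivalences as frames *)

Definition linear_part (c : frame) : 'M[R]_3 :=
  \matrix_i emb R (nth (dir1 c) [:: dir1 c; dir2 c; dir3 c] i).

Definition frame_map (c : frame) (x : 'rV[R]_3) : 'rV[R]_3 :=
  x *m linear_part c + emb R (apex c).

Lemma emb_comb c p : emb R (comb c p) = emb R p *m linear_part c.
Proof.
case: p => [[x y] z]; rewrite /comb !embD !embZ.
apply/rowP => j; rewrite [RHS]mxE !big_ord_recl big_ord0 addr0 !embE !mxE.
by [].
Qed.

Lemma frame_map_emb c p : frame_map c (emb R p) = emb R (transport c p).
Proof. by rewrite /frame_map -emb_comb addrC -embD. Qed.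

Lemma linear_part_comp a c : linear_part (comp_frame a c) = linear_part c *m linear_part a.
Proof.
apply/row_matrixP; apply: ord3P; rewrite row_mul !rowK /= emb_comb; congr (_ *m _);
  by rewrite rowK.
Qed.

Lemma frame_map_comp a c x : frame_map (comp_frame a c) x = frame_map a (frame_map c x).
Proof.
rewrite /frame_map linear_part_comp mulmxA mulmxDl -addrA; congr (_ + _).
rewrite -emb_comb -embD /= /transport.
by move: (apex a) (comb _ _) => [[? ?] ?] [[? ?] ?]; congr emb; pt_ring.
Qed.

Lemma linear_part_std : linear_part std_frame = 1%:M.
Proof.
apply/matrixP => i j; rewrite !mxE.
by move: i j; do 2 apply: ord3P.
Qed.

Lemma frame_map_std x : frame_map std_frame x = x.
Proof.
rewrite /frame_map linear_part_std mulmx1 (_ : emb R _ = 0) ?addr0 //.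
by apply/rowP; apply: ord3P; rewrite embE mxE.
Qed.

Lemma frame_map_inv c : dual_frame c -> cancel (frame_map c) (frame_map (inv_frame c)).
Proof. by move=> fc x; rewrite -frame_map_comp comp_inv_frame // frame_map_std. Qed.

Lemma frame_map_invK c : dual_frame c -> cancel (frame_map (inv_frame c)) (frame_map c).
Proof.
move=> fc x; have fi := dual_inv fc.
have injc : injective (frame_map (inv_frame c)) := can_inj (frame_map_inv fi).
by apply: injc; rewrite frame_map_inv.
Qed.

(** The image of the origin is a lattice point [u]. Subtracting it leaves a linear map that sends
    the lattice onto itself; preimages of the unit vectors supply its integer inverse. *)
Lemma integrally_equivalentP P Q : integrally_equivalent P Q <->
  exists2 c, dual_frame c & frame_map c @` P = Q.
Proof.
split=> [[f [[A [b fE]] [f_lat _ f_surj] fPQ]]|[c fc cPQ]]; last first.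
  exists (frame_map c); split=> //; first by exists (linear_part c), (emb R (apex c)).
  split=> [_ /latticeP [p ->]|x y _ _|_ /latticeP [p ->]].
  - by apply/latticeP; exists (transport c p); rewrite frame_map_emb.
  - exact: (can_inj (frame_map_inv fc)).
  - exists (emb R (coords c p)); first by apply/latticeP; exists (coords c p).
    by rewrite frame_map_emb coordsK.
have emb_lat p : lattice R 3 (emb R p) by apply/latticeP; exists p.
have /latticeP [u uE] := f_lat _ (emb_lat (0, 0, 0)%coqZ).
have emb0 : emb R (0, 0, 0)%coqZ = 0.
  by apply/rowP; apply: ord3P; rewrite embE mxE.
rewrite fE emb0 mul0mx add0r in uE.
have lin p : exists q, emb R p *m A = emb R q.
  have /latticeP [q qE] := f_lat _ (emb_lat p).
  by exists (psub q u); rewrite embB -qE fE uE addrK.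
have lin' q : exists p, emb R q = emb R p *m A.
  have [x /latticeP [p ->]] := f_surj _ (emb_lat (padd q u)).
  by rewrite fE uE embD => /addIr e; exists p.
pose e (i : 'I_3) : pt := nth (0, 0, 0)%coqZ [:: (1, 0, 0); (0, 1, 0); (0, 0, 1)]%coqZ i.
have e1 : \matrix_i emb R (e i) = 1%:M.
  apply/matrixP => i j; rewrite !mxE.
  by move: i j; do 2 apply: ord3P.
have /fin_all_exists [d dE] (i : 'I_3) := lin (e i).
have /fin_all_exists [m mE] (i : 'I_3) := lin' (e i).
have dA : \matrix_i emb R (d i) = A.
  by rewrite -[RHS]mul1mx -e1; apply/row_matrixP => i; rewrite row_mul !rowK dE.
have mA : (\matrix_i emb R (m i)) *m A = 1%:M.
  by rewrite -e1; apply/row_matrixP => i; rewrite row_mul !rowK mE.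
have mx_emb (g : 'I_3 -> pt) : \matrix_i emb R (g i) = map_mx intr (\matrix_i iemb (g i)).
  by apply/matrixP => i j; rewrite !mxE.
have md : (\matrix_i iemb (m i)) *m (\matrix_i iemb (d i)) = 1%:M.
  have := mA; rewrite -dA !mx_emb -map_mxM -(map_mx1 intr) => /matrixP md.
  by apply/matrixP => i j; have := md i j; rewrite ![map_mx _ _ i j]mxE => /intr_inj.
have [c [fc cu [c1 c2 c3] _]] := frame_of_mx u md.
exists c => //; rewrite -fPQ; congr (_ @` _); apply/funext => x.
rewrite fE /frame_map cu -uE; congr (_ *m _ + _); rewrite -dA.
apply/row_matrixP; apply: ord3P; rewrite !rowK /=; congr emb; apply: iemb_inj.
- by rewrite c1 rowK.
- by rewrite c2 rowK.
- by rewrite c3 rowK.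
Qed.

Lemma image_frame_map_inv c P : dual_frame c ->
  frame_map (inv_frame c) @` (frame_map c @` P) = P.
Proof.
move=> fc; apply/seteqP; split=> [_ [_ [x Px <-] <-]|x Px]; first by rewrite frame_map_inv.
by exists (frame_map c x); [exists x | rewrite frame_map_inv].
Qed.

Lemma integrally_equivalent_sym P Q : integrally_equivalent P Q -> integrally_equivalent Q P.
Proof.
move=> /integrally_equivalentP [c fc <-]; apply/integrally_equivalentP.
exists (inv_frame c); first exact: dual_inv.
exact: image_frame_map_inv.
Qed.

Lemma integrally_equivalent_trans Q P P' :
  integrally_equivalent P Q -> integrally_equivalent Q P' -> integrally_equivalent P P'.
Proof.
move=> /integrally_equivalentP [c fc <-] /integrally_equivalentP [a fa <-].
apply/integrally_equivalentP; exists (comp_frame a c); first exact: dual_comp.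
rewrite image_comp (_ : frame_map (comp_frame a c) = frame_map a \o frame_map c) //.
by apply/funext => x; rewrite frame_map_comp.
Qed.

Lemma pairing_mul (x : 'rV[R]_3) (A : 'M[R]_3) v : pairing (x *m A) v = pairing x (A *m v).
Proof. by rewrite /pairing mulmxA. Qed.

Lemma frame_map_sub c x y : frame_map c x - frame_map c y = (x - y) *m linear_part c.
Proof. by rewrite /frame_map mulmxBl opprD addrACA subrr addr0. Qed.

Lemma vertices_frame_map c P x : dual_frame c -> vertices P x ->
  vertices (frame_map c @` P) (frame_map c x).
Proof.
move=> fc [Px [v vx]]; split; first by exists x.
exists (linear_part (inv_frame c) *m v) => _ [y Py <-] yx.
rewrite frame_map_sub pairing_mul mulmxA -linear_part_comp comp_inv_frame //.
rewrite linear_part_std mul1mx.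
by apply: vx => // xy; apply: yx; rewrite xy.
Qed.

Lemma vertices_image c P : dual_frame c ->
  vertices (frame_map c @` P) = frame_map c @` vertices P.
Proof.
move=> fc; apply/seteqP; split=> [y|_ [x Px <-]]; last exact: vertices_frame_map.
move=> /(vertices_frame_map (dual_inv fc)); rewrite image_frame_map_inv // => Py.
by exists (frame_map (inv_frame c) y) => //; rewrite frame_map_invK.
Qed.

Definition body (V : seq pt) : set 'rV[R]_3 := convex_hull (@emb R @` [set` V]).

Lemma frame_map_convex c x y (t : R) :
  frame_map c (t *: x + (1 - t) *: y) = t *: frame_map c x + (1 - t) *: frame_map c y.
Proof.
rewrite /frame_map mulmxDl -!scalemxAl !scalerDr addrACA -scalerDl.
by rewrite [t + _]addrC subrK scale1r.
Qed.

Lemma realizes_equivalent P S Q c : lattice_hull P S -> realizes S Q c ->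
  (forall p, (forall h, h \in Q.2 -> sat p h) -> body Q.1 (emb R p)) ->
  integrally_equivalent (body Q.1) P.
Proof.
move=> [SP PE] [fc QS SQ] Q_hull; apply/integrally_equivalentP; exists c => //.
apply/seteqP; split=> [_ [x Qx <-]|].
  have := Qx; apply: (hull_sub (B := [set x | P (frame_map c x)]))
    => [y z t t0 t1 /= Py Pz|_ [p pQ <-]] /=.
    by rewrite frame_map_convex; move: Py Pz; rewrite PE; exact: hull_convex.
  by rewrite frame_map_emb; apply/SP/QS.
rewrite {1}PE; apply: hull_sub => [_ _ t t0 t1 [y By <-] [z Bz <-]|_ [p pS <-]].
  by exists (t *: y + (1 - t) *: z); [exact: hull_convex | rewrite frame_map_convex].
exists (emb R (coords c p)); last by rewrite frame_map_emb coordsK.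
by apply: Q_hull => h hQ; apply: SQ.
Qed.

End SmoothPolytope.

Arguments body : clear implicits.

(** * From polytopes in the list to smooth polytopes *)

Section Bodies.

Variable R : realType.

Lemma dual_frame_mx c : dual_frame c ->
  (\matrix_i iemb (nth (dir1 c) [:: dir1 c; dir2 c; dir3 c] i) : 'M_3)
  *m (\matrix_(k, i) (iemb (nth (nrm1 c) [:: nrm1 c; nrm2 c; nrm3 c] i)) 0 k : 'M_3) = 1%:M.
Proof.
move=> fc; have [[e11 e12 e13] [e21 e22 e23] [e31 e32 e33]] := dual_frame_dot fc.
apply/matrixP => i j; rewrite [LHS]mxE.
transitivity (int_of_Z (dot (nth (nrm1 c) [:: nrm1 c; nrm2 c; nrm3 c] j)
                            (nth (dir1 c) [:: dir1 c; dir2 c; dir3 c] i))).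
  by rewrite int_dot !mxE; apply: eq_bigr => k _; rewrite !mxE.
rewrite [RHS]mxE; move: i j; apply: ord3P; apply: ord3P;
  by rewrite /= ?e11 ?e12 ?e13 ?e21 ?e22 ?e23 ?e31 ?e32 ?e33.
Qed.

Lemma frame_lattice_basis c : dual_frame c ->
  lattice_basis (fun i => (iemb (nth (nrm1 c) [:: nrm1 c; nrm2 c; nrm3 c] i))^T).
Proof.
move=> /dual_frame_mx; set D := \matrix_i _; set N := \matrix_(k, i) _ => DN w.
have ND := mulmx1C DN.
have sumE (a : {ffun 'I_3 -> int}) :
    \sum_i a i *: (iemb (nth (nrm1 c) [:: nrm1 c; nrm2 c; nrm3 c] i))^T = N *m \col_i a i.
  apply/colP => k; rewrite summxE [RHS]mxE; apply: eq_bigr => i _.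
  by rewrite !mxE mulrC.
exists [ffun i => (D *m w) i 0]; split.
  rewrite sumE -[LHS]mul1mx -ND -mulmxA; congr (_ *m _).
  by apply/colP => i; rewrite [RHS]mxE ffunE.
move=> a; rewrite sumE => ->; apply/ffunP => i.
by rewrite ffunE mulmxA DN mul1mx mxE.
Qed.

(** A scalar factor of [b] divides the value 1 of [b] at [d]. *)
Lemma primitive_dual b d : dot b d = Zpos xH -> primitive (iemb b)^T.
Proof.
move=> bd k w bE; have := int_dot b d; rewrite bd bE -scalemxAr mxE.
move: ((_ *m _) 0 0) => x; rewrite [LHS](_ : _ = 1) // => /esym kx.
have : `|k * x| = 1 by rewrite kx.
rewrite normrM; move: k x {kx bE} => k x; rewrite -!abszE -PoszM => -[/eqP].
by rewrite muln_eq1 => /andP[/eqP -> _].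
Qed.

(** Evaluating at the points [apex c + d] shows that members of the normal cone have nonnegative
    coordinates in the basis of normals. The cone is thus an orthant in that basis, and its extreme
    rays are the basis vectors. *)
Lemma unimodular_corner P c : dual_frame c -> P (emb R (apex c)) ->
  (forall d, d \in dirs c -> P (emb R (padd (apex c) d))) ->
  (forall x b, P x -> b \in nrms c -> 0 <= pairing (x - emb R (apex c)) (cemb R b)) ->
  unimodular (normal_cone P (emb R (apex c))).
Proof.
move=> fc Pu Pd Pn; set sg := normal_cone _ _.
have [[e11 e12 e13] [e21 e22 e23] [e31 e32 e33]] := dual_frame_dot fc.
have sn b : b \in nrms c -> sg (cemb R b) by move=> bc x Px; apply: Pn.
have sgd v d : sg v -> d \in dirs c -> 0 <= pairing (emb R d) v.
  by move=> sv dc; have := sv _ (Pd d dc); rewrite embD addrAC subrr add0r.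
have sgD v w : sg v -> sg w -> sg (v + w).
  by move=> sv sw x Px; rewrite pairingDr addr_ge0 ?sv ?sw.
have sgZ a v : 0 <= a -> sg v -> sg (a *: v).
  by move=> a0 sv x Px; rewrite pairingZr mulr_ge0 // sv.
have inN1 : nrm1 c \in nrms c by rewrite mem_head.
have inN2 : nrm2 c \in nrms c by rewrite !inE eqxx orbT.
have inN3 : nrm3 c \in nrms c by rewrite !inE eqxx !orbT.
have inD1 : dir1 c \in dirs c by rewrite mem_head.
have inD2 : dir2 c \in dirs c by rewrite !inE eqxx orbT.
have inD3 : dir3 c \in dirs c by rewrite !inE eqxx !orbT.
have pdn d b : pairing (emb R d) (cemb R b) = zr R (dot b d) by exact: pairing_emb.
have cemb_neq0 b d : dot b d = Zpos xH -> cemb R b != 0.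
  move=> bd; apply/eqP => b0; have := pdn d b; rewrite bd b0.
  by rewrite -(scale0r (0 : 'cV[R]_3)) pairingZr mul0r zr1 => /esym /eqP; rewrite oner_eq0.
have split0 d x y b : d \in dirs c -> sg x -> sg y -> x + y = cemb R b -> dot b d = Z0 ->
    pairing (emb R d) x = 0.
  move=> dc sx sy xy bd; have := pdn d b; rewrite bd -xy pairingDr => /eqP.
  by rewrite paddr_eq0 ?sgd // => /andP[/eqP].
exists (fun i => (iemb (nth (nrm1 c) [:: nrm1 c; nrm2 c; nrm3 c] i))^T).
  exact: frame_lattice_basis.
apply/seteqP; split=> [v [v_prim [sv v0 v_ext]]|_ [i _ <-]]; last first.
  move: i; apply: ord3P; rewrite /=; split.
  - exact: primitive_dual e11.
  - split; [exact: sn | exact: cemb_neq0 e11 | move=> x y sx sy xy].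
    exists (pairing (emb R (dir1 c)) x); first exact: sgd.
    rewrite {1}(col_frame x fc) (split0 (dir2 c) x y (nrm1 c)) // (split0 (dir3 c) x y (nrm1 c)) //.
    by rewrite !scale0r !addr0.
  - exact: primitive_dual e22.
  - split; [exact: sn | exact: cemb_neq0 e22 | move=> x y sx sy xy].
    exists (pairing (emb R (dir2 c)) x); first exact: sgd.
    rewrite {1}(col_frame x fc) (split0 (dir1 c) x y (nrm2 c)) // (split0 (dir3 c) x y (nrm2 c)) //.
    by rewrite !scale0r addr0 add0r.
  - exact: primitive_dual e33.
  - split; [exact: sn | exact: cemb_neq0 e33 | move=> x y sx sy xy].
    exists (pairing (emb R (dir3 c)) x); first exact: sgd.
    rewrite {1}(col_frame x fc) (split0 (dir1 c) x y (nrm3 c)) // (split0 (dir2 c) x y (nrm3 c)) //.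
    by rewrite !scale0r !add0r.
have [q vE] : exists q, v = (iemb q)^T by exists (pt_of v^T); rewrite pt_ofK trmxK.
rewrite {v}vE in v_prim sv v0 v_ext *.
have qE : cemb R q = zr R (dot q (dir1 c)) *: cemb R (nrm1 c)
   + zr R (dot q (dir2 c)) *: cemb R (nrm2 c) + zr R (dot q (dir3 c)) *: cemb R (nrm3 c).
  by rewrite {1}(col_frame (cemb R q) fc) !pdn.
have q_ge0 d : d \in dirs c -> 0 <= zr R (dot q d) by move=> dc; rewrite -pdn sgd.
(* An extreme ray has at most one nonzero coordinate in the basis [nrm_i]. *)
have single b d b' d' b'' d'' : b \in nrms c -> b' \in nrms c -> b'' \in nrms c ->
    d \in dirs c -> d' \in dirs c -> d'' \in dirs c ->
    cemb R q = zr R (dot q d) *: cemb R b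
      + (zr R (dot q d') *: cemb R b' + zr R (dot q d'') *: cemb R b'') ->
    dot b d = Zpos xH -> dot b d' = Z0 -> dot b d'' = Z0 ->
    dot q d <> Z0 -> dot q d' = Z0 /\ dot q d'' = Z0.
  move=> bc b'c b''c dc d'c d''c qE' bd bd' bd'' qd.
  have [|||r r0 rE] := v_ext (zr R (dot q d) *: cemb R b)
    (zr R (dot q d') *: cemb R b' + zr R (dot q d'') *: cemb R b'').
  - by apply: sgZ; [exact: q_ge0 | exact: sn].
  - by apply: sgD; apply: sgZ; rewrite ?q_ge0 //; apply: sn.
  - by rewrite -qE'.
  have r_neq0 : r != 0.
    apply/eqP => r0'; have := congr1 (pairing (emb R d)) rE.
    rewrite r0' scale0r pairingZr pdn bd zr1 mulr1 -(scale0r (0 : 'cV[R]_3)) pairingZr mul0r.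
    by rewrite -(zr0 R) => /zr_inj.
  have coord0 e : dot b e = Z0 -> dot q e = Z0.
    move=> be; have := congr1 (pairing (emb R e)) rE.
    rewrite !pairingZr !pdn be zr0 mulr0 => /esym /eqP; rewrite mulf_eq0 (negbTE r_neq0) /=.
    by rewrite -(zr0 R) => /eqP /zr_inj.
  by split; apply: coord0.
have prim1 b d : dot b d = Zpos xH -> d \in dirs c ->
    cemb R q = zr R (dot q d) *: cemb R b -> q = b.
  move=> bd dc qb; have qZ : q = pscale (dot q d) b.
    apply: (emb_inj (R := R)); apply: trmx_inj; rewrite -!cembT qb !cembT embZ.
    by rewrite linearZ.
  have k1 : `|int_of_Z (dot q d)| = 1.
    by apply: (v_prim _ (iemb b)^T); rewrite -linearZ -iembZ -qZ.
  have := q_ge0 d dc; rewrite /zr ler0z => k0; rewrite ger0_norm // in k1.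
  suff k1' : dot q d = Zpos xH by rewrite qZ k1' pscale1.
  exact: (can_inj int_of_ZK).
have [q1|q1] := Z.eq_dec (dot q (dir1 c)) 0; last first.
  have qE1 := qE; rewrite -addrA in qE1.
  have [q2 q3] := single _ _ _ _ _ _ inN1 inN2 inN3 inD1 inD2 inD3 qE1 e11 e21 e31 q1.
  by exists 0 => //=; rewrite (prim1 _ _ e11) // {1}qE q2 q3 zr0 !scale0r !addr0.
have [q2|q2] := Z.eq_dec (dot q (dir2 c)) 0; last first.
  have qE2 := qE; rewrite [X in _ = X + _]addrC -addrA in qE2.
  have [_ q3] := single _ _ _ _ _ _ inN2 inN1 inN3 inD2 inD1 inD3 qE2 e22 e12 e32 q2.
  by exists 1 => //=; rewrite (prim1 _ _ e22) // {1}qE q1 q3 zr0 !scale0r addr0 add0r.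
exists 2%:R => //=; rewrite (prim1 _ _ e33) // {1}qE q1 q2 zr0 !scale0r !add0r //.
Qed.

Variables (m : nat) (Q : poly) (smQ : smooth_poly m Q).

Let P := body R Q.1.

Lemma body_inside p : body R Q.1 (emb R p) <-> inside Q p.
Proof.
split=> [Pp|/(poly_hull smQ)
  [v [w [vQ wQ /and4P[/Z.leb_le t0 /Z.leb_le tn /Z.ltb_lt n0 /pt_eqbP e]]]]].
  apply/insideP => h hQ; rewrite /sat -(zr_le R) -pairing_emb.
  apply: (hull_halfspace (A := @emb R @` [set` Q.1])) Pp => _ [v vQ <-].
  rewrite pairing_emb zr_le; have /insideP := poly_inside smQ vQ; exact.
move: e t0 tn n0; set d := psub w v; move: (dot (psub p v) d) (dot d d) => t n e t0 tn n0.
have n_gt0 : 0 < zr R n by rewrite ltNge -(zr0 R) zr_le; apply/negP => /Z.leb_le; lia.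
have -> : emb R p = (zr R t / zr R n) *: emb R w + (1 - zr R t / zr R n) *: emb R v.
  apply: (scalerI (lt0r_neq0 n_gt0)).
  rewrite scalerDr !scalerA mulrBr mulr1 mulrCA divff ?lt0r_neq0 // mulr1.
  have := congr1 (@emb R) e; rewrite !embZ !embB !scalerBr => /eqP.
  by rewrite subr_eq => /eqP ->; rewrite scalerBl addrAC addrA.
apply: hull_convex.
- by apply: divr_ge0; [rewrite zr_le0; apply/Z.leb_le | exact: ltW].
- by rewrite ler_pdivrMr // mul1r zr_le; apply/Z.leb_le.
- by apply: sub_hull; exists w.
- by apply: sub_hull; exists v.
Qed.

Lemma body_corner v : v \in Q.1 -> exists c, [/\ dual_frame c, apex c = v,
  forall d, d \in dirs c -> P (emb R (padd (apex c) d))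
  & forall x b, P x -> b \in nrms c -> 0 <= pairing (x - emb R (apex c)) (cemb R b)].
Proof.
move=> vQ; have [c [fc cv cn cd]] := poly_corner smQ vQ; exists c; split=> //.
  by move=> d dc; apply/body_inside; rewrite cv; apply: cd.
move=> x b Px bc; rewrite cv pairingBl subr_ge0.
apply: (hull_halfspace (A := @emb R @` [set` Q.1])) Px => _ [w wQ <-].
rewrite -subr_ge0 -pairingBl -embB pairing_emb zr_le0; apply/Z.leb_le.
by apply: cn => //; exact: (poly_inside smQ wQ).
Qed.

Lemma vertices_body : vertices P = @emb R @` [set` Q.1].
Proof.
apply/seteqP; split=> [u [Pu [f fu]]|_ [v vQ <-]].
  apply: contrapT => uQ.
  (* A vertex outside [Q.1] would be strictly below the minimum of [f] on [Q.1], which bounds [f]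
     from below on the whole hull. *)
  have [v0 v0Q vmin] : exists2 v, v \in Q.1 &
      forall w, w \in Q.1 -> pairing (emb R v) f <= pairing (emb R w) f.
    have := poly_vertices smQ; elim: (Q.1) => // v s IHs _.
    have [->|/IHs [w ws wmin]] := eqVneq s [::].
      by exists v; rewrite ?mem_head // => w; rewrite inE => /eqP ->.
    have [le|lt] := leP (pairing (emb R w) f) (pairing (emb R v) f).
      by exists w; rewrite ?inE ?ws ?orbT // => x /orP[/eqP -> //|/wmin].
    exists v; rewrite ?mem_head // => x; rewrite inE => /orP[/eqP -> //|/wmin].
    exact: le_trans (ltW lt).
  have Pv : P (emb R v0) by apply: sub_hull; exists v0.
  have := fu _ Pv; rewrite pairingBl subr_gt0 => fv.
  have : pairing u f < pairing u f.
    apply: lt_le_trans (fv _) _; first by move=> vu; apply: uQ; exists v0.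
    by apply: (hull_halfspace (A := @emb R @` [set` Q.1])) Pu => _ [w wQ <-]; apply: vmin.
  by rewrite ltxx.
have [c [fc cv _ cn]] := body_corner vQ.
split; first by apply: sub_hull; exists v.
(* The sum of the three normals is nonnegative on the cone and vanishes only at its apex. *)
exists (cemb R (nrm1 c) + cemb R (nrm2 c) + cemb R (nrm3 c)) => x Px xv; rewrite cv in cn.
rewrite !pairingDr; have n1 := cn x (nrm1 c) Px.
have n2 := cn x (nrm2 c) Px; have n3 := cn x (nrm3 c) Px.
rewrite /nrms !inE !eqxx !orbT in n1 n2 n3.
have {}n1 := n1 isT; have {}n2 := n2 isT; have {}n3 := n3 isT.
rewrite lt_neqAle addr_ge0 ?addr_ge0 // andbT eq_sym; apply/eqP => /eqP.
rewrite paddr_eq0 ?addr_ge0 // paddr_eq0 // => /andP[/andP[/eqP e1 /eqP e2] /eqP e3].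
apply: xv; apply/eqP; rewrite -subr_eq0 (row_frame (x - _) fc) e1 e2 e3.
by rewrite !scale0r !addr0.
Qed.

Lemma body_small : small_smooth_polytopes R 3 m P.
Proof.
have V0 := poly_vertices smQ.
have [v0 v0Q] : exists v, v \in Q.1 by case: (Q.1) V0 => // v s _; exists v; rewrite mem_head.
split; first split.
- exists (@emb R @` [set` Q.1]); split=> //.
    by apply: finite_image; exact: finite_seq.
  by move=> _ [v _ <-]; apply/latticeP; exists v.
- have [c [fc cv cd _]] := body_corner v0Q.
  exists (emb R v0), (linear_part R c); split.
  + by apply: sub_hull; exists v0.
  + apply: ord3P; rewrite rowK -embD -cv; apply: cd; rewrite !inE /= eqxx ?orbT //.
  + rewrite row_free_unit; have := linear_part_comp R (inv_frame c) c.
    by rewrite comp_inv_frame // linear_part_std => /esym /mulmx1_unit [].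
- move=> u; rewrite vertices_body => -[v vQ <-].
  have [c [fc cv cd cn]] := body_corner vQ; rewrite -cv; apply: unimodular_corner => //.
  by rewrite cv; apply: sub_hull; exists v.
have [L Lm PL] := poly_points smQ.
apply: card_le_trans (_ : P `&` lattice R 3 #<= @emb R @` [set` L]) _.
  apply: subset_card_le => x [Px /latticeP [p xE]]; exists p => //=.
  by apply: PL; apply/body_inside; rewrite -xE.
apply: card_le_trans (card_image_le _ _) _.
have -> : [set` L] = [set` undup L] by apply/seteqP; split=> p /=; rewrite mem_undup.
apply: (@card_le_trans _ _ _ `I_(size (undup L))).
  by have := card_set_seq (undup_uniq L); rewrite card_eq_le => /andP[].
by rewrite card_le_II (leq_trans (size_undup L)).
Qed.

Lemma card_vertices_body : vertices P #= `I_(size Q.1).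
Proof.
rewrite vertices_body; apply: card_eq_trans (card_set_seq (poly_uniq smQ)).
exact: (inj_card_eq (in2W (@emb_inj R))).
Qed.

End Bodies.

(** * Equivalence classes *)

Lemma card_equivalence_classes (R : realType) (X : set (set 'rV[R]_3)) (Qs : seq poly) :
  uniq Qs -> (forall Q, Q \in Qs -> X (body R Q.1)) ->
  (forall P, X P -> exists2 Q, Q \in Qs & integrally_equivalent (body R Q.1) P) ->
  {in Qs &, forall Q Q', integrally_equivalent (body R Q.1) (body R Q'.1) -> Q = Q'} ->
  equivalence_classes X #= `I_(size Qs).
Proof.
move=> Qs_uniq QsX X_Qs Qs_inj.
pose F (Q : poly) := [set P | X P /\ integrally_equivalent (body R Q.1) P].
have equiv_refl P : @integrally_equivalent R 3 P P.
  apply/integrally_equivalentP; exists std_frame; first exact: check_dualP.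
  by apply/seteqP; split=> [_ [x Px <-]|x Px]; [|exists x]; rewrite ?frame_map_std.
rewrite (_ : equivalence_classes X = F @` [set` Qs]).
  apply: card_eq_trans (card_set_seq Qs_uniq); apply: inj_card_eq.
  move=> Q Q' /set_mem QQs /set_mem Q'Qs FQ.
  apply: Qs_inj => //; have : F Q' (body R Q'.1) by split; [exact: QsX | exact: equiv_refl].
  by rewrite -FQ => -[].
have equivF P Q : integrally_equivalent (body R Q.1) P ->
    [set P' | X P' /\ integrally_equivalent P P'] = F Q.
  move=> QP; apply/seteqP; split=> P' [XP' PP']; split=> //.
    exact: (integrally_equivalent_trans QP PP').
  exact: (integrally_equivalent_trans (integrally_equivalent_sym QP) PP').
apply/seteqP; split=> [_ [P XP <-]|_ [Q QQs <-]].
  by have [Q QQs QP] := X_Qs P XP; exists Q => //; rewrite (equivF P Q).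
by exists (body R Q.1); [exact: QsX | exact: equivF].
Qed.

Lemma smooth_polys Q : Q \in polys -> smooth_poly 12 Q.
Proof. by move=> Qp; apply: check_polyP; move/allbP: polys_checked; apply; apply/In_mem. Qed.

(** An equivalence maps vertices onto vertices, so the transported vertex list of [Q] is a
    permutation of that of [Q'] and the invariants agree. *)
Lemma polys_inequivalent (R : realType) :
  {in polys &, forall Q Q', integrally_equivalent (body R Q.1) (body R Q'.1) -> Q = Q'}.
Proof.
move=> Q Q' Qp Q'p /integrally_equivalentP [c fc cQ].
have [smQ smQ'] := (smooth_polys Qp, smooth_polys Q'p).
have QQ' : perm_eq (map (transport c) Q.1) Q'.1.
  apply: uniq_perm; [|exact: (poly_uniq smQ')|].
    by rewrite (map_inj_uniq (can_inj (transportK fc))) (poly_uniq smQ).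
  have eV : frame_map c @` (@emb R @` [set` Q.1]) = @emb R @` [set` Q'.1].
    by rewrite -(vertices_body R smQ) -(vertices_body R smQ') -vertices_image ?cQ.
  move=> p; apply/mapP/idP => [[v vQ ->]|pQ'].
    have : (@emb R @` [set` Q'.1]) (emb R (transport c v)).
      by rewrite -eV -frame_map_emb; exists (emb R v) => //; exists v.
    by case=> w wQ' /emb_inj <-.
  have : (@emb R @` [set` Q'.1]) (emb R p) by exists p.
  by rewrite -eV => -[_ [v vQ <-]]; rewrite frame_map_emb => /emb_inj <-; exists v.
have sQ : simplex_sum Q.1 = simplex_sum Q'.1.
  by rewrite -(simplex_sum_map _ fc); apply: simplex_sum_perm.
have iQ : (index Q polys < size polys)%N by rewrite index_mem.
have iQ' : (index Q' polys < size polys)%N by rewrite index_mem.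
rewrite -(nth_index Q Qp) -[RHS](nth_index Q Q'p); congr nth; apply/eqP.
rewrite -(nth_uniq 0%R _ _ simplex_sum_uniq) ?size_map //.
by rewrite !(nth_map Q) // !nth_index // sQ.
Qed.

Lemma small_smooth_polytope_equivalent (R : realType) (P : set 'rV[R]_3) :
  small_smooth_polytopes R 3 12 P ->
  exists2 Q, Q \in polys & integrally_equivalent (body R Q.1) P.
Proof.
move=> [P_smooth P12]; have [S [hPS smS S0]] := smooth_polytope_points P_smooth P12.
have [Q [c [Qp Qc]]] := smooth_points_classification smS S0.
exists Q => //; apply: (realizes_equivalent hPS Qc) => p Qp'.
by apply/(body_inside R (smooth_polys Qp))/insideP.
Qed.

Lemma card_classes_with_vertices (R : realType) k :
  equivalence_classes (small_smooth_polytopes_with_vertices R 3 12 k)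
  #= `I_(size [seq Q <- polys | size Q.1 == k]).
Proof.
apply: card_equivalence_classes.
- by rewrite filter_uniq // (map_uniq simplex_sum_uniq).
- move=> Q; rewrite mem_filter => /andP[/eqP <- /smooth_polys smQ].
  by split; [exact: (body_small R smQ) | exact: (card_vertices_body R smQ)].
- move=> P [P_small Pk]; have [Q Qp QP] := small_smooth_polytope_equivalent P_small.
  exists Q => //; rewrite mem_filter Qp andbT; apply/eqP/card_eq_II.
  apply: card_eq_trans Pk; rewrite card_eq_sym.
  case/integrally_equivalentP: QP => c fc <-; rewrite vertices_image //.
  apply: card_eq_trans (card_vertices_body R (smooth_polys Qp)).
  exact: (inj_card_eq (in2W (can_inj (frame_map_inv fc)))).
- move=> Q Q'; rewrite !mem_filter => /andP[_ Qp] /andP[_ Q'p].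
  exact: polys_inequivalent.
Qed.

Theorem theorem31 (R : realType) :
  equivalence_classes (small_smooth_polytopes R 3 12) #= `I_33 /\
  equivalence_classes (small_smooth_polytopes_with_vertices R 3 12 4) #= `I_2 /\
  equivalence_classes (small_smooth_polytopes_with_vertices R 3 12 6) #= `I_25 /\
  equivalence_classes (small_smooth_polytopes_with_vertices R 3 12 8) #= `I_6 /\
  equivalence_classes (small_smooth_polytopes_with_vertices R 3 12 10) #= `I_0 /\
  equivalence_classes (small_smooth_polytopes_with_vertices R 3 12 12) #= `I_0.
Proof.
(* The sizes of the filtered lists evaluate to 2, 25, 6, 0 and 0 by conversion. *)
split; last by do ?split; apply: card_classes_with_vertices.
apply: (@card_equivalence_classes R _ polys).
- exact: (map_uniq simplex_sum_uniq).
- by move=> Q /smooth_polys smQ; apply: (body_small R smQ).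
- exact: small_smooth_polytope_equivalent.
- exact: polys_inequivalent.
Qed.
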